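(* Let $(B_t)_{t\ge 0}$ be a standard one-dimensional Brownian motion started at $0$, let $\nu,l\in\mathbb{R}$, and set $B^{(\nu)}_s=B_s+\nu s$ and $g^{(\nu)}_l(t)=\sup\{s\le t:\ B^{(\nu)}_s=l\}$. For $0\le s<t<\infty$ let $\mathcal{F}_{s,t}=\sigma\{B_u,\ u\le s;\ B_v,\ v\ge t\}$. Then, almost surely, $$\mathbb{P}\left(g^{(\nu)}_l(t)\le s\ \middle|\ \mathcal{F}_{s,t}\right)=\left(1-\exp\left(-\frac{2}{t-s}\,(B^{(\nu)}_s-l)(B^{(\nu)}_t-l)\right)\right)^{+}.$$
   Context: Convention: $\sup\emptyset=0$. Notation: $x^+=\max(x,0)$. *)

(* Defs.v *)
From HB Require Import structures.
From mathcomp Require Import all_boot all_order all_algebra.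
From mathcomp Require Import all_classical all_reals all_analysis.

Set Implicit Arguments.
Unset Strict Implicit.
Unset Printing Implicit Defensive.

Import Order.TTheory GRing.Theory Num.Theory.
Import numFieldNormedType.Exports.

Local Open Scope classical_set_scope.
Local Open Scope ring_scope.

Section probability_notions.
Context d (T : measurableType d) (R : realType) (P : probability T R).

(* The product rule for the whole family gives the one for subfamilies, by
   taking some of the Borel sets [Y i] equal to [setT]. *)
Definition mutually_independent n (X : 'I_n -> T -> R) :=
  forall Y : 'I_n -> set R, (forall i, measurable (Y i)) ->
  P (\bigcap_(i in [set: 'I_n]) (X i @^-1` Y i)) =
  (\prod_(i < n) P (X i @^-1` Y i))%E.

(* The time set is [0, +oo[: the variables [B t] with [t < 0] are never
   constrained. [normal_prob] takes a standard deviation, whence the root. *)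
Record brownian_motion (B : R -> {RV P >-> R}) : Prop := BrownianMotion {
  bm_start : {ae P, forall w, B 0 w = 0} ;
  bm_indep : forall n (t : nat -> R), 0 <= t 0%N ->
    (forall i, (i < n)%N -> t i <= t i.+1) ->
    mutually_independent (fun i : 'I_n => B (t i.+1) \- B (t i)) ;
  bm_gauss : forall s t, 0 <= s -> s < t -> forall Y, measurable Y ->
    pushforward P (B t \- B s) Y = normal_prob 0 (Num.sqrt (t - s)) Y ;
  bm_continuous : forall w, {within `[0, +oo[, continuous (fun t => B t w)} }.

(* [Z] is a version of the conditional probability of [A] given the
   sigma-algebra [<<s C>>]. *)
Record cond_prob (C : set (set T)) (A : set T) (Z : T -> R) : Prop := CondProb {
  cond_prob_measurable :
    measurable_fun [set: g_sigma_algebraType C] (Z : g_sigma_algebraType C -> R) ;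
  cond_prob_integrable : P.-integrable setT (EFin \o Z) ;
  cond_prob_integral : forall E, <<s C>> E ->
    (\int[P]_(w in E) (Z w)%:E)%E = P (A `&` E) }.

End probability_notions.

Section drifted_process.
Context (T : Type) (R : realType) (B : R -> T -> R).

Definition drifted (nu s : R) (w : T) : R := B s w + nu * s.

(* [sup set0 = 0] in the library. *)
Definition last_passage (nu l t : R) (w : T) : R :=
  sup [set s | 0 <= s <= t /\ drifted nu s w = l].

(* Generators of sigma(B_u, u <= s; B_v, v >= t). *)
Definition past_future (s t : R) : set (set T) :=
  \bigcup_(u in [set u | 0 <= u <= s \/ t <= u])
    preimage_set_system setT (B u) measurable.

End drifted_process.

(* Main.v *)
Require Import Defs.
From HB Require Import structures.
From mathcomp Require Import all_boot all_order all_algebra.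
From mathcomp Require Import all_classical all_reals all_analysis.
From mathcomp Require Import measurable_realfun ring lra.

(* Let X be the drifted path minus l. The event is that X has no zero in
   ]s, t]. Write X_u = x + (B_u - B_s) + nu (u - s) with x = X_s. The increments
   of B over [s, t] are independent of the past of s and of the increments after
   t, so conditioning on F_{s,t} amounts to freezing x and the value
   y = X_t, and it suffices to prove, for each real x, that
     P (no zero, X_t in D) = E [(1 - exp (- 2 x X_t / (t - s)))^+ ; X_t in D].
   For x <> 0, take psi Lipschitz with support in {y | 0 < x y} and put
   psi~ y = psi y - exp (- 2 nu y) psi (- y). Reflecting the Gaussian density
   gives E [psi~ (X_t - X_u)] = 0 for every u, so E [psi~ (X_t) | X_u = y] is
   O(|y|). Stopping X at the end of the first step of a fine grid of [s, t] that
   contains a zero, where |X| is small by continuity, shows that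
   E [psi~ (X_t) ; no zero] = E [psi~ (X_t)]. The left-hand side is
   E [psi (X_t) ; no zero], and by the same Gaussian reflection the right-hand
   side is E [psi (X_t) (1 - exp (- 2 x X_t / (t - s)))]. *)

Set Implicit Arguments.
Unset Strict Implicit.
Unset Printing Implicit Defensive.

Import Order.TTheory GRing.Theory Num.Theory.
Import numFieldNormedType.Exports.

Local Open Scope classical_set_scope.
Local Open Scope ring_scope.

(** * Independence and bounded integrals *)

Section independent_systems.
Context d (T : measurableType d) (R : realType) (P : probability T R).

(** The weight [exp (- 2 nu y)] is the ratio of the densities at [- y] and at [y] of a Gaussian
    variable of mean [nu r] and variance [r]. It does not depend on [r], so a single function psi~
    has mean zero over [[u, t]] for every [u]. The obstacle is that the first zero is a random time.
    No strong Markov property is used: the path is restarted only at the deterministic times of the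
    grid. The support of psi is bounded because the exponential weight would otherwise destroy
    boundedness and the Lipschitz property of psi~. A zero at [s] is compatible with the event,
    whence an interval open at [s]. For [x != 0] this changes nothing. For [x = 0] the stopping
    argument has nothing to stop, and the start is moved slightly to either side of 0 instead. *)

Definition indep_systems (C1 C2 : set (set T)) :=
  forall A1 A2, C1 A1 -> C2 A2 -> (P (A1 `&` A2) = P A1 * P A2)%E.

Lemma indep_systemsC C1 C2 : indep_systems C1 C2 -> indep_systems C2 C1.
Proof. by move=> h A1 A2 H1 H2; rewrite setIC h// muleC. Qed.

Lemma sub_indep_systems C1 C2 D1 D2 : D1 `<=` C1 -> D2 `<=` C2 ->
  indep_systems C1 C2 -> indep_systems D1 D2.
Proof. by move=> s1 s2 h A1 A2 /s1 H1 /s2 H2; exact: h. Qed.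

Lemma g_sigma_measurable (C : set (set T)) :
  C `<=` measurable -> <<s C >> `<=` measurable.
Proof. by apply: smallest_sub; exact: sigma_algebra_measurable. Qed.

(** For a fixed [B] in [D], the finite measures [mrestr P mB] and [P B] times [P] agree on the
    pi-system [C], hence on the sigma-algebra that it generates. *)
Lemma indep_g_sigma_l (C D : set (set T)) :
  C `<=` measurable -> setI_closed C -> C setT -> D `<=` measurable ->
  indep_systems C D -> indep_systems <<s C >> D.
Proof.
move=> Cm CI CT Dm CD A B sA DB.
have mB := Dm _ DB.
have PB0 : 0 <= fine (P B) by rewrite fine_ge0.
pose m1 := mrestr P mB.
pose m2 := mscale (NngNum PB0) P.
have m2E X : m2 X = (P X * P B)%E.
  by rewrite /m2 /mscale/= fineK ?fin_num_measure// muleC.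
rewrite -m2E.
apply: (@g_sigma_algebra_measure_unique d R T C Cm (fun=> setT) (fun=> CT) _ m1 m2) => //.
- by rewrite bigcup_const.
- by move=> A' CA'; rewrite -[RHS]/(m2 A') m2E; exact: CD.
- by move=> _; rewrite /m1/= /mrestr setTI ltey_eq fin_num_measure.
Qed.

Lemma indep_g_sigma (C D : set (set T)) :
  C `<=` measurable -> setI_closed C -> C setT ->
  D `<=` measurable -> setI_closed D -> D setT ->
  indep_systems C D -> indep_systems <<s C >> <<s D >>.
Proof.
move=> Cm CI CT Dm DI DT CD; apply: indep_systemsC.
apply: indep_g_sigma_l => //; first exact: g_sigma_measurable.
by apply: indep_systemsC; exact: indep_g_sigma_l.
Qed.

End independent_systems.

Section generated_by_family.
Context d (T : measurableType d) (R : realType) (I : Type).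
Implicit Types (D : set I) (f : I -> T -> R) (C : set (set T)).

(** The shape is that of [past_future], which is the instance with family [B] and times
    [0 <= u <= s] or [t <= u]. *)
Definition gen_family D f : set (set T) :=
  \bigcup_(i in D) preimage_set_system setT (f i) measurable.

Lemma gen_family_measurable D f :
  (forall i, D i -> measurable_fun setT (f i)) ->
  gen_family D f `<=` measurable.
Proof. by move=> mf _ [i Di [Y mY <-]]; exact: mf. Qed.

Lemma measurable_gen_family D f i : D i ->
  measurable_fun [set: g_sigma_algebraType (gen_family D f)]
    (f i : g_sigma_algebraType (gen_family D f) -> R).
Proof.
move=> Di _ Y mY; apply: sub_sigma_algebra; exists i => //.
by exists Y.
Qed.

Lemma sub_g_sigma_family C D f :
  (forall i, D i -> measurable_fun [set: g_sigma_algebraType C]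
    (f i : g_sigma_algebraType C -> R)) ->
  <<s gen_family D f >> `<=` <<s C >>.
Proof.
move=> mf; apply: smallest_sub; first exact: smallest_sigma_algebra.
move=> _ [i Di [Y mY <-]].
exact: (mf i Di (@measurableT _ _) Y mY).
Qed.

Lemma gen_familyS D D' f : D `<=` D' ->
  <<s gen_family D f >> `<=` <<s gen_family D' f >>.
Proof.
by move=> DD'; apply: sub_g_sigma_family => i /DD'; exact: measurable_gen_family.
Qed.

End generated_by_family.

Section indep_fin.
Context d (T : measurableType d) (R : realType) (P : probability T R).
Variables (I J : choiceType).

(* Finite subfamilies suffice: the union of the sigma-algebras that they
   generate is a pi-system. *)
Lemma indep_families (D1 : set I) (f : I -> T -> R) (D2 : set J) (g : J -> T -> R) :
  (forall i, measurable_fun setT (f i)) ->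
  (forall i, measurable_fun setT (g i)) ->
  (forall s1 s2, indep_systems P
     <<s gen_family (D1 `&` [set` (s1 : seq I)]) f >>
     <<s gen_family (D2 `&` [set` (s2 : seq J)]) g >>) ->
  indep_systems P <<s gen_family D1 f >> <<s gen_family D2 g >>.
Proof.
move=> mf mg H.
pose fin (K : choiceType) (D : set K) (h : K -> T -> R) : set (set T) :=
  [set E | exists s : seq K, <<s gen_family (D `&` [set` s]) h >> E].
have finm K D h : (forall i, measurable_fun setT (h i)) -> fin K D h `<=` measurable.
  by move=> mh E [s]; apply: g_sigma_measurable; exact: gen_family_measurable.
have finI K D h : setI_closed (fin K D h).
  move=> E E' [s Es] [s' Es']; exists (s ++ s').
  apply: (@measurableI _ (g_sigma_algebraType (gen_family (D `&` [set` s ++ s']) h))).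
    apply: gen_familyS Es => i [Di /= si]; split => //=.
    by rewrite mem_cat si.
  apply: gen_familyS Es' => i [Di /= si]; split => //=.
  by rewrite mem_cat si orbT.
have finT K D h : fin K D h setT.
  exists [::].
  exact: (@measurableT _ (g_sigma_algebraType (gen_family (D `&` [set` [::]]) h))).
have finS K D h : <<s gen_family D h >> `<=` <<s fin K D h >>.
  apply: smallest_sub; first exact: smallest_sigma_algebra.
  move=> _ [i Di [Y mY <-]]; apply: sub_sigma_algebra; exists [:: i].
  apply: sub_sigma_algebra; exists i; last by exists Y.
  by split => //=; rewrite inE.
apply: sub_indep_systems (finS I D1 f) (finS J D2 g) _.
apply: indep_g_sigma => //; [exact: finm|exact: finm|].
move=> E1 E2 [s1 E1s] [s2 E2s]; exact: H E1s E2s.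
Qed.

End indep_fin.

Section bounded_integrals.
Context d (T : measurableType d) (R : realType) (P : probability T R).

Lemma bounded_integrable (f : T -> R) (M : R) : measurable_fun setT f ->
  (forall w, `|f w| <= M) -> P.-integrable setT (EFin \o f).
Proof.
move=> mf fM; apply: (@le_integrable _ _ _ P _ measurableT _ (cst M%:E)).
- exact/measurable_EFinP.
- move=> x _ /=; rewrite lee_fin (le_trans (fM x))// ler_norm//.
- exact: finite_measure_integrable_cst.
Qed.

Lemma norm_Rintegral_bounded (f : T -> R) (M : R) : measurable_fun setT f ->
  (forall w, `|f w| <= M) -> `|\int[P]_w f w| <= M.
Proof.
move=> mf fM; have intf := bounded_integrable mf fM.
apply: (le_trans (le_normr_Rintegral _ intf)) => //.
have ic : P.-integrable setT (EFin \o cst M) by exact: finite_measure_integrable_cst.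
apply: (@le_trans _ _ (\int[P]_w cst M w)).
  by apply: le_Rintegral => //; exact: (integrable_norm intf).
by rewrite Rintegral_cst//= probability_setT/= mulr1.
Qed.

Lemma bounded_cvg_Rintegral (f_ : (T -> R)^nat) (f : T -> R) (M : R) :
  (forall n, measurable_fun setT (f_ n)) ->
  (forall n w, `|f_ n w| <= M) -> (forall w, f_ ^~ w @ \oo --> f w) ->
  (\int[P]_w f_ n w) @[n --> \oo] --> \int[P]_w f w.
Proof.
move=> mf_ fM ff.
have mf : measurable_fun setT f.
  by apply: (@measurable_fun_cvg _ _ _ _ f_ f) => // w _; exact: ff.
have [|||||iF _ +] := @dominated_convergence _ T R P setT measurableT
  (fun n => EFin \o f_ n) (EFin \o f) (cst M%:E).
- by move=> n; exact/measurable_EFinP.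
- exact/measurable_EFinP.
- by apply: aeW => w _; apply/cvg_EFin; [exact: nearW|exact: ff].
- exact: finite_measure_integrable_cst.
- by apply: aeW => w n _; rewrite lee_fin.
rewrite -[X in _ --> X -> _]fineK; last exact: integrable_fin_num.
by move/fine_cvgP => [_].
Qed.

End bounded_integrals.

Section fubini_indep.
Context d d1 d2 (T : measurableType d) (T1 : measurableType d1)
  (T2 : measurableType d2) (R : realType) (P : probability T R).
Variables (X : T -> T1) (Y : T -> T2).
Hypotheses (mX : measurable_fun setT X) (mY : measurable_fun setT Y).
Hypothesis XY : forall A B, measurable A -> measurable B ->
  (P ((X @^-1` A) `&` (Y @^-1` B)) = P (X @^-1` A) * P (Y @^-1` B))%E.

Let mfX := HB.pack_for {mfun T >-> T1} X (isMeasurableFun.Build _ _ _ _ _ mX).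
Let mfY := HB.pack_for {mfun T >-> T2} Y (isMeasurableFun.Build _ _ _ _ _ mY).

(** By uniqueness of the product measure, the joint law of [X] and [Y] is the product of their laws.
    The target spaces are arbitrary so that [X] or [Y] can be the identity from [T] to [T] with a
    smaller sigma-algebra; [H] may then depend on a whole portion of the path. *)
Lemma indep_Fubini (H : T1 * T2 -> R) (M : R) : measurable_fun setT H ->
  (forall z, `|H z| <= M) ->
  \int[P]_w H (X w, Y w) = \int[P]_w1 \int[P]_w2 H (X w1, Y w2).
Proof.
move=> mH HM.
pose Z w := (X w, Y w).
have mZ : measurable_fun setT Z by exact/measurable_fun_pair.
pose mfZ := HB.pack_for {mfun T >-> (T1 * T2)%type} Z
  (isMeasurableFun.Build _ _ _ _ _ mZ).
pose P1 : probability T1 R := distribution P mfX.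
pose P2 : probability T2 R := distribution P mfY.
pose P12 : probability (T1 * T2)%type R := distribution P mfZ.
have P12E A : measurable A -> (P1 \x P2)%E A = P12 A.
  by apply: product_measure_unique => A1 A2 mA1 mA2; rewrite -XY.
have intH : (P1 \x P2)%E.-integrable setT (EFin \o H).
  apply/integrableP; split; first exact/measurable_EFinP.
  rewrite (@eq_measure_integral _ _ _ _ P12); last first.
    by move=> A mA _; exact: P12E.
  by have /integrableP[] := @bounded_integrable _ _ _ P12 H M mH HM.
have HZ : (\int[P]_w (H (X w, Y w))%:E =
           \int[P1]_w1 \int[P2]_w2 (H (w1, w2))%:E)%E.
  transitivity (\int[P12]_z (H z)%:E)%E.
    rewrite [RHS]integral_pushforward//; first exact/measurable_EFinP.
    by apply: (@bounded_integrable _ _ _ _ _ M) => //=; exact: measurableT_comp.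
  transitivity (\int[(P1 \x P2)%E]_z (H z)%:E)%E.
    by apply: eq_measure_integral => A mA _; exact/esym/P12E.
  by rewrite -(integral12_prod_meas1 intH).
have mH1 w1 : measurable_fun setT (fun w2 => H (w1, w2)).
  exact: measurableT_comp.
have inner w1 : (\int[P2]_w2 (H (w1, w2))%:E =
           (\int[P]_w2 H (w1, Y w2))%:E)%E.
  rewrite [LHS]integral_pushforward//=; last 2 first.
    exact/measurable_EFinP.
    exact: (bounded_integrable P (measurableT_comp (mH1 w1) mY) (fun=> HM _)).
  rewrite /Rintegral fineK//; apply: integrable_fin_num => //.
  apply: (@bounded_integrable _ _ _ _ (fun w2 => H (w1, Y w2)) M) => //=.
  exact: (measurableT_comp (mH1 w1) mY).
have mF : measurable_fun setT (fun w1 => \int[P]_w2 H (w1, Y w2)).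
  apply/measurable_EFinP; have := measurable_fubini_F intH.
  by apply: eq_measurable_fun => w1 _; rewrite /= -inner.
rewrite {1}/Rintegral HZ {1}/Rintegral; congr fine.
transitivity (\int[P1]_w1 (\int[P]_w2 H (w1, Y w2))%:E)%E.
  by apply: eq_integral => w1 _; exact: inner.
rewrite [LHS]integral_pushforward//=; first exact/measurable_EFinP.
apply: (@bounded_integrable _ _ _ _ (fun w => \int[P]_w2 H (X w, Y w2)) M) => /=.
  exact: (measurableT_comp mF mX).
by move=> w; apply: norm_Rintegral_bounded => //; exact: (measurableT_comp (mH1 _) mY).
Qed.

End fubini_indep.

(** * Independence of Brownian increments *)

Section grouping.
Context d (T : measurableType d) (R : realType) (P : probability T R).

(** Cylinders whose sides are [setT] outside a group form a pi-system generating the sigma-algebra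
    of that group. When a cylinder of each group is intersected, one of the two sides is trivial at
    every index, so the product splits factor by factor. *)
Lemma indep_groups n (X : 'I_n -> T -> R) (p : pred 'I_n) :
  (forall i, measurable_fun setT (X i)) -> mutually_independent P X ->
  indep_systems P <<s gen_family [set i | p i] X >>
                  <<s gen_family [set i | ~~ p i] X >>.
Proof.
move=> mX indX.
pose cyl (q : pred 'I_n) : set (set T) := [set E | exists Y : 'I_n -> set R,
  [/\ forall i, measurable (Y i), forall i, ~~ q i -> Y i = setT &
      E = \bigcap_(i in [set: 'I_n]) (X i @^-1` Y i)]].
have cylm q : cyl q `<=` measurable.
  move=> _ [Y [mY _ ->]]; apply: fin_bigcap_measurable => // i _.
  by rewrite -[X in measurable X]setTI; exact: mX.
have cylI q : setI_closed (cyl q).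
  move=> _ _ [Y [mY qY ->]] [Y' [mY' qY' ->]].
  exists (fun i => Y i `&` Y' i); split.
  - by move=> i; exact: measurableI.
  - by move=> i qi; rewrite qY// qY'// setTI.
  - by rewrite -bigcapI.
have cylT q : cyl q setT.
  exists (fun=> setT); split => //.
  by apply/esym; rewrite -subTset => w _ i _.
have cylS (q : pred 'I_n) : <<s gen_family [set i | q i] X >> `<=` <<s cyl q >>.
  apply: smallest_sub; first exact: smallest_sigma_algebra.
  move=> _ [i /= qi [Y mY <-]]; apply: sub_sigma_algebra.
  exists (fun j => if j == i then Y else setT); split.
  - by move=> j; case: ifP.
  - by move=> j; case: eqP => // ->; rewrite qi.
  - apply/seteqP; split => w /=.
      by move=> [_ Yw] j _ /=; case: eqP => // ->.
    by move=> /(_ i I) /=; rewrite eqxx.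
apply: sub_indep_systems (cylS p) (cylS (predC p)) _.
apply: indep_g_sigma => // _ _ [Y [mY pY ->]] [Y' [mY' pY' ->]].
rewrite -bigcapI (indX (fun i => Y i `&` Y' i)); last first.
  by move=> i; exact: measurableI.
rewrite !indX// -big_split/=; apply: eq_bigr => i _.
have [pi|npi] := boolP (p i).
  by rewrite pY' ?negbK//= setIT preimage_setT probability_setT mule1.
by rewrite pY//= setTI preimage_setT probability_setT mul1e.
Qed.

(** An event on [Z] is null or of full measure, according to whether [Y] contains [c]. This is what
    makes [B 0], which is 0 only almost surely, harmless. *)
Lemma ae_const_indep (Z : T -> R) (c : R) (Y : set R) (E : set T) :
  measurable_fun setT Z -> {ae P, forall w, Z w = c} ->
  measurable Y -> measurable E ->
  (P ((Z @^-1` Y) `&` E) = P (Z @^-1` Y) * P E)%E.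
Proof.
move=> mZ [N [mN PN0 NZ]] mY mE.
have mZY Y' : measurable Y' -> measurable (Z @^-1` Y').
  by move=> mY'; rewrite -[X in measurable X]setTI; exact: mZ.
have null Y' F : measurable Y' -> measurable F -> ~ Y' c -> P (Z @^-1` Y' `&` F) = 0%E.
  move=> mY' mF Y'c; apply: (@subset_measure0 _ _ _ P _ N) => //.
    by apply: measurableI => //; exact: mZY.
  move=> w [/= Yw _]; apply: NZ => /= Zw; apply: Y'c; by rewrite -Zw.
have [Yc|Yc] := pselect (Y c); last first.
  by rewrite null// -[X in P X]setIT null// mul0e.
have nullC F : measurable F -> P (~` (Z @^-1` Y) `&` F) = 0%E.
  by move=> mF; apply: (null (~` Y)) => //; exact: measurableC.
have full F : measurable F -> P (Z @^-1` Y `&` F) = P F.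
  move=> mF; rewrite -[in RHS](setTI F) -(setUv (Z @^-1` Y)) setIUl.
  rewrite measureU.
  - by rewrite [X in (_ + X)%E](nullC F mF) adde0.
  - by apply: measurableI => //; exact: mZY.
  - by apply: measurableI => //; apply: measurableC; exact: mZY.
  - by rewrite setIACA setICr set0I.
by rewrite full// -[X in (P X * _)%E]setIT full// probability_setT mul1e.
Qed.

End grouping.

(** Measurability is asked only of the terms that occur, because the lemma serves for
    sub-sigma-algebras that make no other increment measurable. *)
Lemma measurable_sum_nat d (T : measurableType d) (R : realType)
    (f : nat -> T -> R) (a b : nat) :
  (forall i, (a <= i < b)%N -> measurable_fun setT (f i)) ->
  measurable_fun setT (fun w => \sum_(a <= i < b) f i w).
Proof.
move=> mf; pose g i := if (a <= i < b)%N then f i else cst 0.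
have -> : (fun w => \sum_(a <= i < b) f i w) = (fun w => \sum_(a <= i < b) g i w).
  by apply/funext => w; apply: eq_big_nat => i iab; rewrite /g iab.
by apply: measurable_sum => i; rewrite /g; case: ifPn => // iab; exact: mf.
Qed.

Section brownian_increments.
Context d (T : measurableType d) (R : realType) (P : probability T R).
Variable B : R -> {RV P >-> R}.
Hypothesis BM : brownian_motion B.

(* The initial term [B 0] is almost surely constant, hence independent of
   everything; with it, every [B (c k)] is a sum of the [chain_incr c i]. *)
Definition chain_incr (c : nat -> R) (i : nat) : T -> R :=
  if i is j.+1 then B (c j.+1) \- B (c j) else B 0.

Lemma measurable_chain_incr c i : measurable_fun setT (chain_incr c i).
Proof. by case: i => [|i] /=; [|apply: measurable_funB]. Qed.

Lemma chain_incr_indep n (c : nat -> R) : c 0%N = 0 ->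
  (forall i, (i < n)%N -> c i <= c i.+1) ->
  mutually_independent P (fun i : 'I_n.+1 => chain_incr c i).
Proof.
move=> c0 cS Y mY; rewrite big_ord_recl/=.
have -> : \bigcap_(i in [set: 'I_n.+1]) (chain_incr c i @^-1` Y i) =
    B 0 @^-1` Y ord0 `&` \bigcap_(i in [set: 'I_n])
      ((B (c i.+1) \- B (c i)) @^-1` Y (lift ord0 i)).
  apply/seteqP; split => w.
    move=> H; split; first exact: (H ord0 I).
    by move=> i _; exact: (H (lift ord0 i) I).
  move=> [H0 H] i _; have [j ->|->//] := unliftP ord0 i.
  exact: (H j I).
rewrite (ae_const_indep _ (bm_start BM))//.
  congr (_ * _)%E; rewrite (bm_indep BM)//; first by rewrite c0.
apply: fin_bigcap_measurable => // i _.
by rewrite -[X in measurable X]setTI; apply: measurable_funB.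
Qed.

Lemma sum_chain_incr c (j k : nat) w : (j <= k)%N ->
  \sum_(j.+1 <= i < k.+1) chain_incr c i w = B (c k) w - B (c j) w.
Proof.
move=> jk; rewrite -(telescope_sumr (fun i => B (c i) w))// big_add1/=.
exact: eq_big_nat.
Qed.

Lemma sum0_chain_incr c (k : nat) w : c 0%N = 0 ->
  \sum_(0 <= i < k.+1) chain_incr c i w = B (c k) w.
Proof.
by move=> c0; rewrite big_ltn// sum_chain_incr// c0 addrC subrK.
Qed.

(* After [t], [B u] depends on the increments over [r, t], but [B u - B t] does
   not. *)
Definition outer_var (r t u : R) : T -> R :=
  if u <= r then B u else B u \- B t.
Definition inner_var (r u : R) : T -> R := B u \- B r.
Definition outer_idx (r t : R) : set R := [set u | 0 <= u <= r \/ t <= u].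
Definition inner_idx (r t : R) : set R := [set u | r <= u <= t].

Lemma measurable_outer_var r t u : measurable_fun setT (outer_var r t u).
Proof. by rewrite /outer_var; case: ifP => // _; apply: measurable_funB. Qed.

Lemma measurable_inner_var r u : measurable_fun setT (inner_var r u).
Proof. exact: measurable_funB. Qed.

(** For finitely many times, sort them into one chain. Outer variables are sums of increments over
    steps outside [[r, t]], inner ones over steps inside, and [indep_groups] separates the two kinds
    of steps. *)
Lemma outer_inner_indep (r t : R) : 0 <= r -> r < t ->
  indep_systems P <<s gen_family (outer_idx r t) (outer_var r t) >>
                  <<s gen_family (inner_idx r t) (inner_var r) >>.
Proof.
move=> r0 rt; apply: indep_families.
- by move=> u; exact: measurable_outer_var.
- by move=> u; exact: measurable_inner_var.
move=> s1 s2.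
have t0 : 0 <= t by rewrite (le_trans r0)// ltW.
(* With [r] and [t] in the list no step straddles either of them, and with 0 the chain starts at
   [B 0]. *)
pose l : seq R := [:: 0, r, t & [seq u <- s1 ++ s2 | 0 <= u]].
pose ts : seq R := sort <=%O (undup l).
have l0 (u : R) : u \in l -> 0 <= u.
  rewrite !inE => /or4P[/eqP->|/eqP->|/eqP->|]//.
  by rewrite mem_filter => /andP[].
have tsl (u : R) : (u \in ts) = (u \in l) by rewrite mem_sort mem_undup.
have tss : sorted <%O ts by rewrite sort_lt_sorted undup_uniq.
pose c i : R := nth 0 ts i.
have clt i j : (i < size ts)%N -> (j < size ts)%N -> (c i < c j) = (i < j)%N.
  by move=> si sj; rewrite /c lt_sorted_ltn_nth.
have cle i j : (i < size ts)%N -> (j < size ts)%N -> (c i <= c j) = (i <= j)%N.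
  by move=> si sj; rewrite leNgt (clt _ _ sj si) -leqNgt.
have cidx (u : R) : u \in ts -> (index u ts < size ts)%N /\ c (index u ts) = u.
  by move=> uts; rewrite index_mem uts /c nth_index.
have [n sizets] : exists n, size ts = n.+1.
  have : 0 \in ts by rewrite tsl inE eqxx.
  by case: (ts) => // a b _; exists (size b).
have c0 : c 0%N = 0.
  apply/eqP; rewrite eq_le; apply/andP; split; last first.
    by apply: l0; rewrite -tsl mem_nth// sizets.
  have [i0 ci0] := cidx 0 (eq_trans (tsl 0) (mem_head _ _)).
  by rewrite -[leRHS]ci0 cle// sizets.
have cS i : (i < n)%N -> c i <= c i.+1.
  by move=> iln; rewrite cle ?sizets// ltnW.
have [ir cr] : (index r ts < size ts)%N /\ c (index r ts) = r.
  by apply: cidx; rewrite tsl !inE eqxx orbT.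
have [it ct] : (index t ts < size ts)%N /\ c (index t ts) = t.
  by apply: cidx; rewrite tsl !inE eqxx !orbT.
(* Term [i] is the increment from [c i.-1] to [c i]; it is outer when that step ends by [r] or
   begins at [t] or later. The initial term [B 0] is outer, since [c 0 = 0 <= r]. *)
pose p (i : 'I_n.+1) := (c i <= r) || (t <= c i.-1).
pose X (i : 'I_n.+1) := chain_incr c i.
have mX i : measurable_fun setT (X i) by exact: measurable_chain_incr.
have mp (q : pred 'I_n.+1) i (iln : (i < n.+1)%N) : q (Ordinal iln) ->
  measurable_fun [set: g_sigma_algebraType (gen_family [set i | q i] X)]
    (chain_incr c i : g_sigma_algebraType (gen_family [set i | q i] X) -> R).
  by move=> qi; exact: (@measurable_gen_family _ T R _ [set i | q i] X (Ordinal iln)).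
apply: (sub_indep_systems _ _ (indep_groups mX (chain_incr_indep c0 cS) (p := p))).
- apply: sub_g_sigma_family => u [Du /= us1].
  have u0 : 0 <= u by case: Du => [/andP[]//|]; exact: le_trans.
  have [iu cu] : (index u ts < size ts)%N /\ c (index u ts) = u.
    by apply: cidx; rewrite tsl !inE mem_filter u0 mem_cat us1 !orbT.
  rewrite /outer_var; case: ifPn => [ur|].
    have -> : (B u : T -> R) =
        (fun w => \sum_(0 <= i < (index u ts).+1) chain_incr c i w).
      by apply/funext => w; rewrite sum0_chain_incr// cu.
    apply: measurable_sum_nat => i /= iu'.
    have iln : (i < n.+1)%N by rewrite -sizets (leq_ltn_trans _ iu).
    apply: (mp p _ iln); rewrite /p/=.
    by rewrite (le_trans _ ur)// -[leRHS]cu cle// sizets.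
  rewrite -ltNge => ru.
  have tu : t <= u by case: Du => // /andP[_]; rewrite leNgt ru.
  have itu : (index t ts <= index u ts)%N by rewrite -cle// ct cu.
  have : measurable_fun [set: g_sigma_algebraType (gen_family [set i | p i] X)]
      (fun w => \sum_((index t ts).+1 <= i < (index u ts).+1) chain_incr c i w : R).
    apply: measurable_sum_nat => i /= /andP[i1 i2].
    have iln : (i < n.+1)%N by rewrite -sizets (leq_ltn_trans _ iu).
    apply: (mp p _ iln); rewrite /p/=; apply/orP; right.
    rewrite -[leLHS]ct cle//.
      by rewrite -ltnS (ltn_predK i1).
    by rewrite sizets (leq_ltn_trans (leq_pred _)).
  apply: eq_measurable_fun => w _; by rewrite sum_chain_incr// cu ct.
- apply: sub_g_sigma_family => u [/= /andP[ru ut] us2].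
  have u0 : 0 <= u by exact: le_trans ru.
  have [iu cu] : (index u ts < size ts)%N /\ c (index u ts) = u.
    by apply: cidx; rewrite tsl !inE mem_filter u0 mem_cat us2 !orbT.
  have iru : (index r ts <= index u ts)%N by rewrite -cle// cr cu.
  rewrite /inner_var.
  have : measurable_fun [set: g_sigma_algebraType (gen_family [set i | ~~ p i] X)]
      (fun w => \sum_((index r ts).+1 <= i < (index u ts).+1) chain_incr c i w : R).
    apply: measurable_sum_nat => i /= /andP[i1 i2].
    have iln : (i < n.+1)%N by rewrite -sizets (leq_ltn_trans _ iu).
    apply: (mp (predC p) _ iln); rewrite /p/= negb_or -!ltNge.
    have isz : (i < size ts)%N by rewrite sizets.
    have i1sz : (i.-1 < size ts)%N by rewrite (leq_ltn_trans (leq_pred _)).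
    rewrite -[ltLHS]cr clt// i1/=.
    rewrite (lt_le_trans _ ut)// -[ltRHS]cu clt//.
    by rewrite prednK ?(leq_trans _ i1)// -ltnS.
  apply: eq_measurable_fun => w _; by rewrite sum_chain_incr// cu cr.
Qed.

End brownian_increments.

(** * Paths without zeros *)

Section uniform_grid.
Context {R : realType}.

(** Heine's theorem. A radius that works at [u] for [e / 2] gives, when halved, one that works for
    [e] at all points near [u]; compactness, in its near-covering form, makes it uniform. *)
Lemma segment_unif_continuous (f : R -> R) (a b e : R) :
  {within `[a, b], continuous f} -> 0 < e -> exists2 del, 0 < del &
  forall u v, a <= u <= b -> a <= v <= b -> `|u - v| < del -> `|f u - f v| < e.
Proof.
move=> /subspace_continuousP cf e0.
pose Q (del u : R) := a <= u <= b -> forall v, a <= v <= b ->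
  `|u - v| < del -> `|f u - f v| < e.
have /compact_near_coveringP/near_covering_withinP := @segment_compact R a b.
move=> /(_ _ (0:R)^'+ (fun del u => Q del u) _) H.
have {}H : \forall del \near 0^'+, forall u, `[a, b]%classic u -> Q del u.
  apply: H => u /= uab.
  have /cvgrPdist_lt /(_ (e / 2)) := cf u uab.
  rewrite divr_gt0// => /(_ isT); rewrite near_withinE => /nbhs_ballP[d /= d0 Hd].
  exists (ball u (d / 2), [set del | 0 < del < d / 2]) => /=.
    split; first by apply/filterS: (nbhsx_ballx u (d / 2) (divr_gt0 d0 (ltr0n _ 2))).
    near=> del; apply/andP; split; near: del; first exact: nbhs_right_gt.
    by apply: nbhs_right_lt; rewrite divr_gt0.
  move=> [u' del] [/= uu' /andP[del0 deld]] _ u'ab v vab u'v.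
  have B1 : ball u d u' by apply: le_ball uu'; rewrite ler_pdivrMr// ler_pMr// ler1n.
  have B2 : ball u d v.
    rewrite /ball/= -(subrKA u') (le_lt_trans (ler_normD _ _))//.
    rewrite (splitr d) ltrD//; exact: lt_trans deld.
  have /(_ u'ab) H1 := Hd _ B1; have /(_ vab) H2 := Hd _ B2.
  rewrite -(subrKA (f u)) (le_lt_trans (ler_normD _ _))// (splitr e) ltrD//.
  by rewrite distrC.
near (0 : R)^'+ => del.
exists del; first by near: del; exact: nbhs_right_gt.
move=> u v uab vab; have := near H del; apply => //.
Unshelve. all: by end_near. Qed.

Definition grid (a b : R) (n i : nat) := a + (b - a) * (i%:R / n.+1%:R).

Lemma grid0 a b n : grid a b n 0 = a.
Proof. by rewrite /grid mul0r mulr0 addr0. Qed.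

Lemma gridS a b n : grid a b n n.+1 = b.
Proof. by rewrite /grid divff ?pnatr_eq0// mulr1 addrC subrK. Qed.

Lemma grid_le a b n i j : a <= b -> (i <= j)%N -> grid a b n i <= grid a b n j.
Proof.
move=> ab ij; rewrite lerD2l ler_wpM2l ?subr_ge0//.
by rewrite ler_pM2r ?invr_gt0 ?ltr0n// ler_nat.
Qed.

Lemma grid_itv a b n i : a <= b -> (i <= n.+1)%N -> a <= grid a b n i <= b.
Proof.
move=> ab i_n; apply/andP; split.
  by rewrite -[leLHS](grid0 a b n) grid_le.
by rewrite -[leRHS](gridS a b n) grid_le.
Qed.

Lemma grid_step a b n i : grid a b n i.+1 - grid a b n i = (b - a) / n.+1%:R.
Proof.
rewrite /grid opprD addrACA subrr add0r -mulrBr -mulrBl -natr1 addrAC subrr add0r.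
by rewrite mul1r.
Qed.

Lemma near_grid_step a b (e : R) : 0 < e ->
  \forall n \near \oo, (b - a) / n.+1%:R < e.
Proof.
move=> e0; near=> n; rewrite ltr_pdivrMr ?ltr0n//.
rewrite -ltr_pdivrMl// mulrC; apply: (@lt_trans _ _ n%:R); last by rewrite ltr_nat.
near: n; exact: nbhs_infty_gtr.
Unshelve. all: by end_near. Qed.

Lemma grid_cover a b n u : a < b -> a <= u <= b ->
  exists2 i, (i <= n)%N & grid a b n i <= u <= grid a b n i.+1.
Proof.
move=> ab /andP[au ub].
have ex : exists i, u <= grid a b n i.+1 by exists n; rewrite gridS.
case: (ex_minnP ex) => i ui mini; exists i.
  by apply: mini; rewrite gridS.
rewrite ui andbT; case: i ui mini => [|i] ui mini; first by rewrite grid0.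
by rewrite leNgt; apply/negP => /ltW/mini; rewrite ltnn.
Qed.

End uniform_grid.

Definition nonvanishing (S : Type) (R : realType) (f : R -> S -> R)
    (a b : R) : set S :=
  [set p | forall u, a <= u <= b -> f u p != 0].

(** The left end is open because a visit to the level at time [s] exactly still leaves the last
    passage at most [s]. *)
Definition nonvanishing_oc (S : Type) (R : realType) (f : R -> S -> R)
    (a b : R) : set S :=
  [set p | forall u, a < u <= b -> f u p != 0].

Section nonvanishing.
Context d (S : measurableType d) (R : realType).

(** By compactness a continuous path without zeros satisfies [|f| >= 1 / m.+1] for some [m], in
    particular on all grids. Conversely, such a bound on all grids excludes a zero, near which a
    fine grid would have a point with a smaller value. The space [S] is arbitrary so as to allow the
    sigma-algebra of the past, or a product space. *)
Lemma measurable_nonvanishing (f : R -> S -> R) (a b : R) : a <= b ->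
  (forall u, a <= u <= b -> measurable_fun setT (f u)) ->
  (forall p, {within `[a, b], continuous (f ^~ p)}) ->
  measurable (nonvanishing f a b).
Proof.
rewrite le_eqVlt => /predU1P[<-|ab] mf cf.
  have -> : nonvanishing f a a = f a @^-1` (~` [set 0]).
    apply/seteqP; split => p /=.
      by move=> /(_ a); rewrite lexx => /(_ isT)/eqP.
    by move=> fa0 u; rewrite -eq_le => /eqP <-; exact/eqP.
  rewrite -[X in measurable X]setTI; apply: mf; rewrite ?lexx//.
  exact: measurableC.
have -> : nonvanishing f a b = \bigcup_m \bigcap_n \bigcap_(i in [set i | (i <= n.+1)%N])
    [set p | m.+1%:R^-1 <= `|f (grid a b n i) p|].
  apply/seteqP; split => p.
    move=> nv.
    have cn : {within `[a, b], continuous (fun u => `|f u p|)}.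
      move=> u; apply: cvg_norm; exact: cf.
    have [c cab cmin] := EVT_min (ltW ab) cn.
    have fc0 : 0 < `|f c p| by rewrite normr_gt0; apply: nv; rewrite in_itv in cab.
    have [m mc] : exists m : nat, m.+1%:R^-1 <= `|f c p|.
      have [m _ /(_ m (leqnn _))/= mc] := near_infty_natSinv_lt (PosNum fc0).
      by exists m; exact: ltW.
    exists m => // n _ i /= i_n; apply: (le_trans mc); apply: cmin.
    by rewrite in_itv/= grid_itv// ltW.
  move=> [m _ H] u uab; apply/negP => /eqP fu0.
  have m0 : 0 < m.+1%:R^-1 :> R by rewrite invr_gt0.
  have [del del0 Hdel] := segment_unif_continuous (cf p) m0.
  have [n nP] : exists n : nat, (b - a) / n.+1%:R < del.
    have [n _ nP] := near_grid_step a b del0; exists n; exact: (nP n (leqnn _)).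
  have [i i_n /andP[giu ugi]] := grid_cover n ab uab.
  have := H n I i (leq_trans i_n (leqnSn _)); apply/negP; rewrite -ltNge.
  rewrite -[f _ p]subr0 -fu0; apply: Hdel => //.
    by rewrite grid_itv ?ltW// (leq_trans i_n).
  rewrite distrC ger0_norm ?subr_ge0// (le_lt_trans _ nP)//.
  by rewrite -(grid_step a b n i) lerD2r.
apply: bigcupT_measurable => m; apply: bigcapT_measurable => n.
apply: bigcap_measurable; first by exists 0%N.
move=> i i_n; rewrite -[X in measurable X]setTI.
have mfi : measurable_fun setT (fun p => `|f (grid a b n i) p|).
  by apply: measurableT_comp => //; apply: mf; rewrite grid_itv// ltW.
have := mfi measurableT `[m.+1%:R^-1, +oo[%classic (measurable_itv _).
by congr (_ _); apply/seteqP; split => p /=; rewrite in_itv/= andbT.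
Qed.

End nonvanishing.

Lemma lipschitz_measurable (R : realType) (f : R -> R) (L : R) :
  (forall y z, `|f y - f z| <= L * `|y - z|) -> measurable_fun setT f.
Proof.
move=> fL; apply: continuous_measurable_fun => y.
have L0 : 0 <= L by have := fL 1 0; rewrite subr0 normr1 mulr1; exact: le_trans.
have L1 : 0 < L + 1 by rewrite ltr_pwDr.
apply/cvgrPdist_lt => e e0; near=> z.
apply: (le_lt_trans (fL _ _)); apply: (@le_lt_trans _ _ ((L + 1) * `|y - z|)).
  by rewrite ler_wpM2r// lerDl.
rewrite mulrC -ltr_pdivlMr//; near: z.
exact: (nbhsx_ballx y _ (divr_gt0 e0 L1)).
Unshelve. all: by end_near. Qed.

Lemma Rintegral_sum d (T : measurableType d) (R : realType) (P : probability T R)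
    (f : nat -> T -> R) (n : nat) :
  (forall i, P.-integrable setT (EFin \o f i)) ->
  \int[P]_w (\sum_(0 <= i < n) f i w) = \sum_(0 <= i < n) \int[P]_w f i w.
Proof.
move=> intf.
have intS k : P.-integrable setT (EFin \o (fun w => \sum_(0 <= i < k) f i w)).
  elim: k => [|k IH].
    rewrite (_ : _ \o _ = cst 0%E); first exact: integrable0.
    by apply/funext => w /=; rewrite big_nil.
  rewrite (_ : _ \o _ =
      ((EFin \o (fun w => (\sum_(0 <= i < k) f i w)%R)) \+ (EFin \o f k))%E).
    exact: integrableD.
  by apply/funext => w /=; rewrite big_nat_recr.
elim: n => [|n IH].
  rewrite big_nil (_ : (fun w => _) = cst 0); first by rewrite Rintegral_cst// mul0r.
  by apply/funext => w /=; rewrite big_nil.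
rewrite big_nat_recr//= -IH -RintegralD//.
by apply: eq_Rintegral => w _; rewrite big_nat_recr.
Qed.

(** * Stopping at the first grid step that contains a zero *)

Section reflection.
Context d (T : measurableType d) (R : realType) (P : probability T R).
Variables (Y : R -> T -> R) (s t x : R) (psi : R -> R) (C L : R).
Hypotheses (st : s < t) (x0 : x != 0).
Hypothesis mY : forall u, measurable_fun setT (Y u).
Hypothesis Ys : forall w, Y s w = x.
Hypothesis cY : forall w, {within `[s, t], continuous (Y ^~ w)}.
Let hist u := gen_family [set v | s <= v <= u] Y.
Hypothesis indY : forall u, s <= u -> u < t -> forall A D,
  <<s hist u >> A -> measurable D ->
  (P (A `&` [set w | D (Y t w - Y u w)%R]) = P A * P [set w | D (Y t w - Y u w)%R])%E.
Hypothesis psiC : forall y, `|psi y| <= C.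
Hypothesis psiL : forall y z, `|psi y - psi z| <= L * `|y - z|.
Hypothesis psi0 : psi 0 = 0.
Hypothesis psiE : forall u, s <= u -> u < t -> \int[P]_w psi (Y t w - Y u w) = 0.

Let mpsi : measurable_fun setT psi.
Proof. exact: lipschitz_measurable psiL. Qed.

Let C0 : 0 <= C. Proof. exact: le_trans (psiC 0). Qed.

Let L0 : 0 <= L.
Proof. by have := psiL 1 0; rewrite subr0 normr1 mulr1; exact: le_trans. Qed.

(** Bounds the conditional mean of [psi (Y t)] given [Y u = y]. The linear term makes it small near
    a zero, and [C] keeps it bounded for the passage to the limit. *)
Let cap (y : R) : R := Num.min C (L * `|y|).

Let cap_ge0 y : 0 <= cap y.
Proof. by rewrite /cap le_min C0 mulr_ge0. Qed.

Let cap_le y : `|cap y| <= C.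
Proof. by rewrite ger0_norm// ge_min lexx. Qed.

Let mcap u : measurable_fun setT (fun w => cap (Y u w)).
Proof.
apply: measurable_minr; first exact: measurable_cst.
by apply: measurable_funM => //; exact: measurableT_comp.
Qed.

Let hist_measurable u : hist u `<=` measurable.
Proof. by apply: gen_family_measurable => i _; exact: mY. Qed.

(** Given the past of [u], the mean of [psi (Y t)] is [v (Y u)], where [v y] is the mean of
    [psi (y + D)]. The function [v] inherits the bound [C] and the Lipschitz constant [L], and
    [v 0 = 0] by [psiE]; so [|v| <= cap]. *)
Let stopped_bound u (h : T -> R) : s <= u <= t ->
  measurable_fun [set: g_sigma_algebraType (hist u)]
    (h : g_sigma_algebraType (hist u) -> R) ->
  (forall w, 0 <= h w <= 1) ->
  `|\int[P]_w (psi (Y t w) * h w)| <= \int[P]_w (cap (Y u w) * h w).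
Proof.
move=> /andP[su ut] mh h01.
have mhT : measurable_fun setT h.
  by move=> _ D mD; apply: g_sigma_measurable (@hist_measurable u) _ _; exact: mh.
have hle (y : R) w (M : R) : `|y| <= M -> `|y * h w| <= M.
  move=> yM; have /andP[h0 h1] := h01 w.
  by rewrite normrM (ger0_norm h0) (le_trans _ yM)// ler_piMr.
have bound (g : T -> R) : measurable_fun setT g -> (forall w, `|g w| <= cap (Y u w)) ->
    `|\int[P]_w (g w * h w)| <= \int[P]_w (cap (Y u w) * h w).
  move=> mg gcap.
  have intg : P.-integrable setT (EFin \o (fun w => g w * h w)).
    apply: (@bounded_integrable _ _ _ _ _ C); first exact: measurable_funM.
    by move=> w; apply: hle; rewrite (le_trans (gcap w))// ge_min lexx.
  apply: (le_trans (le_normr_Rintegral _ intg)) => //.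
  apply: le_Rintegral => //; first exact: (integrable_norm intg).
    apply: (@bounded_integrable _ _ _ _ _ C); first exact: measurable_funM.
    by move=> w; apply: hle; exact: cap_le.
  move=> w _; have /andP[h0 _] := h01 w.
  by rewrite normrM (ger0_norm h0) ler_wpM2r.
(* At [u = t] no increment remains and [psiE] says nothing, but [psi 0 = 0] already bounds [psi] by
   [cap]. *)
move: ut; rewrite le_eqVlt => /predU1P[ut|ut].
  apply: bound => [|w]; first exact: measurableT_comp.
  rewrite /cap le_min psiC/= ut; have := psiL (Y t w) 0.
  by rewrite psi0 !subr0.
pose D w := Y t w - Y u w.
have mD : measurable_fun setT D by exact: measurable_funB.
pose v y := \int[P]_w psi (y + D w).
have mpsiD y : measurable_fun setT (fun w => psi (y + D w)).
  by apply: measurableT_comp => //; exact: measurable_funD.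
have ipsiD y : P.-integrable setT (EFin \o (fun w => psi (y + D w))).
  by apply: (@bounded_integrable _ _ _ _ _ C).
have vL y z : `|v y - v z| <= L * `|y - z|.
  rewrite /v -RintegralB//; apply: norm_Rintegral_bounded.
    exact: measurable_funB.
  by move=> w; rewrite (le_trans (psiL _ _))// opprD addrACA subrr addr0.
have v0 : v 0 = 0.
  by rewrite /v -[RHS](psiE su ut); apply: eq_Rintegral => w _; rewrite add0r.
have vcap y : `|v y| <= cap y.
  rewrite le_min; apply/andP; split; first exact: norm_Rintegral_bounded.
  by have := vL y 0; rewrite v0 !subr0.
(* The first coordinate keeps the whole past of [u], since [h] is not a function of [Y u] alone. *)
pose G := g_sigma_algebraType (hist u).
pose H (z : G * R) := psi (Y u z.1 + z.2) * h z.1.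
have mYG : measurable_fun [set: G] (Y u : G -> R).
  by apply: measurable_gen_family => /=; rewrite su lexx.
have mH : measurable_fun setT H.
  apply: measurable_funM; last exact: (measurableT_comp mh measurable_fst).
  apply: measurableT_comp => //; apply: measurable_funD => //.
  exact: (measurableT_comp mYG measurable_fst).
have mid : measurable_fun setT (id : T -> G).
  move=> _ A mA; rewrite setTI; exact: g_sigma_measurable (@hist_measurable u) _ mA.
have := @indep_Fubini _ _ _ T G R R P id D mid mD _ H C mH _.
move=> /(_ _ _)Fub.
have -> : \int[P]_w (psi (Y t w) * h w) = \int[P]_w (v (Y u w) * h w).
  transitivity (\int[P]_w H (w, D w)).
    by apply: eq_Rintegral => w _; rewrite /H/= /D/= addrC subrK.
  rewrite Fub.
  - apply: eq_Rintegral => w _; rewrite /H/= RintegralZr//.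
  - by move=> A B mA mB; exact: indY.
  - by move=> z; exact: hle.
apply: bound => //.
apply: measurableT_comp => //; exact: lipschitz_measurable vL.
Qed.

(** The difference of the two sides is the integral of [psi (Y t)] over the paths with a zero. These
    are sorted by the first grid step containing a zero, and each class is controlled by
    [stopped_bound] at the right end of its step, by which time membership in the class is known. *)
Lemma reflection :
  \int[P]_w (psi (Y t w) * \1_(nonvanishing Y s t) w) = \int[P]_w psi (Y t w).
Proof.
have sle : s <= t := ltW st.
pose g := grid s t.
pose NV u : set T := nonvanishing Y s u.
have NVmono u v : u <= v -> NV v `<=` NV u.
  move=> uv w NVv r /andP[sr ru]; apply: NVv.
  by rewrite sr (le_trans ru).
have mNV u v : s <= u -> u <= v -> v <= t ->
    measurable (NV u : set (g_sigma_algebraType (hist v))).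
  move=> su uv vt.
  apply: (@measurable_nonvanishing _ (g_sigma_algebraType (hist v))) => //.
    move=> r /andP[sr ru]; apply: measurable_gen_family => /=.
    by rewrite sr (le_trans ru).
  have sub : `[s, u]%classic `<=` `[s, t]%classic.
    move=> r /=; rewrite !in_itv/= => /andP[-> ru]/=.
    by rewrite (le_trans ru)// (le_trans uv).
  by move=> p; exact: (continuous_subspaceW sub (@cY p)).
(* The sign makes the telescoping differences [h] nonnegative: [h n i] indicates that step [i] is
   the first one with a zero. *)
pose f n i w : R := - \1_(NV (g n i)) w.
pose h n i w : R := f n i.+1 w - f n i w.
have gi n i : (i <= n.+1)%N -> s <= g n i <= t by exact: grid_itv.
have gS n i : g n i <= g n i.+1 by exact: grid_le.
have hE n i w : h n i w = \1_(NV (g n i) `\` NV (g n i.+1)) w.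
  rewrite /h /f !indicE opprK addrC in_setD.
  have [wi|wi] := boolP (w \in NV (g n i.+1)).
    by rewrite (mem_set (NVmono _ _ (gS n i) _ (set_mem wi))) subrr.
  by rewrite subr0 andbT.
have h01 n i w : 0 <= h n i w <= 1.
  by rewrite hE indicE; case: (_ \in _); rewrite lexx ler01.
have mh n i : (i < n.+1)%N -> measurable_fun
    [set: g_sigma_algebraType (hist (g n i.+1))]
    (h n i : g_sigma_algebraType (hist (g n i.+1)) -> R).
  move=> iln; have /andP[sgi _] := gi n i (ltnW iln).
  have /andP[sgi1 gi1t] := gi n i.+1 iln.
  by apply: measurable_funB; apply: measurableT_comp => //;
    apply/measurable_indicP; exact: mNV.
(* Beyond the grid [h] would not be known to be measurable, whereas [Rintegral_sum] asks for
   integrability at all indices. *)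
pose h' n i w := if (i < n.+1)%N then h n i w else 0.
have h'01 n i w : 0 <= h' n i w <= 1.
  by rewrite /h'; case: ifP => // _; rewrite lexx ler01.
have mh' n i : measurable_fun setT (h' n i).
  have [iln|iln] := boolP (i < n.+1)%N; last first.
    rewrite (_ : h' n i = cst 0); first exact: measurable_cst.
    by apply/funext => w; rewrite /h' (negbTE iln).
  rewrite (_ : h' n i = h n i); last by apply/funext => w; rewrite /h' iln.
  move=> _ D mD; apply: g_sigma_measurable (@hist_measurable (g n i.+1)) _ _; exact: mh.
have sumh n w : \sum_(0 <= i < n.+1) h' n i w = 1 - \1_(NV t) w.
  transitivity (\sum_(0 <= i < n.+1) h n i w).
    by apply: eq_big_nat => i /= iln; rewrite /h' iln.
  rewrite telescope_sumr// /f /g grid0 gridS opprK addrC; congr (_ - _).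
  (* [NV s] is the whole space, because the path starts at [x != 0]. *)
  rewrite indicE mem_set// => r; rewrite -eq_le => /eqP <-.
  by rewrite Ys.
have hle (y M : R) n i w : `|y| <= M -> `|y * h' n i w| <= M.
  move=> yM; have /andP[h0 h1] := h'01 n i w.
  by rewrite normrM (ger0_norm h0) (le_trans _ yM)// ler_piMr.
pose Z n w := \sum_(0 <= i < n.+1) cap (Y (g n i.+1) w) * h' n i w.
have mpsiY : measurable_fun setT (fun w => psi (Y t w)) by exact: measurableT_comp.
have mNVt : measurable (NV t).
  by apply: g_sigma_measurable (@hist_measurable t) _ _; exact: mNV.
have m1 : measurable_fun setT (\1_(NV t) : T -> R) by exact/measurable_indicP.
have ipsi : P.-integrable setT (EFin \o (fun w => psi (Y t w))).
  exact: (@bounded_integrable _ _ _ _ _ C).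
have ipsi1 : P.-integrable setT (EFin \o (fun w => psi (Y t w) * \1_(NV t) w)).
  apply: (@bounded_integrable _ _ _ _ _ C); first exact: measurable_funM.
  move=> w; rewrite normrM (le_trans _ (psiC (Y t w)))// ler_piMr// indicE.
  by case: (_ \in _); rewrite ?normr1 ?normr0.
have key n : `|\int[P]_w psi (Y t w) - \int[P]_w (psi (Y t w) * \1_(NV t) w)|
    <= \int[P]_w Z n w.
  rewrite -RintegralB//.
  have -> : \int[P]_w (psi (Y t w) - psi (Y t w) * \1_(NV t) w) =
      \sum_(0 <= i < n.+1) \int[P]_w (psi (Y t w) * h' n i w).
    rewrite -Rintegral_sum; last first.
      move=> i; apply: (@bounded_integrable _ _ _ _ _ C); first exact: measurable_funM.
      by move=> w; exact: hle.
    by apply: eq_Rintegral => w _; rewrite -mulr_sumr sumh mulrBr mulr1.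
  rewrite /Z Rintegral_sum; last first.
    move=> i; apply: (@bounded_integrable _ _ _ _ _ C); first exact: measurable_funM.
    by move=> w; exact: hle.
  apply: (le_trans (ler_norm_sum _ _ _)); apply: ler_sum_nat => i /= iln.
  rewrite /h' iln; apply: stopped_bound => //; last exact: mh.
  exact: gi.
have Zge0 n w : 0 <= Z n w.
  by apply: sumr_ge0 => i _; rewrite mulr_ge0//; have /andP[] := h'01 n i w.
(* The weights [h' n i w] sum to at most 1, and at most one step is active, so a bound on [cap]
   there bounds [Z]. *)
have Zle n w M : 0 <= M ->
    (forall i, (i < n.+1)%N -> h' n i w != 0 -> cap (Y (g n i.+1) w) <= M) ->
    Z n w <= M.
  move=> M0 hM; apply: (@le_trans _ _ (\sum_(0 <= i < n.+1) M * h' n i w)).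
    apply: ler_sum_nat => i /= iln; have /andP[h0 _] := h'01 n i w.
    have [->|hn0] := eqVneq (h' n i w) 0; first by rewrite !mulr0.
    by rewrite ler_wpM2r// hM.
  by rewrite -mulr_sumr sumh ler_piMr// lerBlDr lerDl indicE ler0n.
have Zcvg w : Z ^~ w @ \oo --> (0 : R).
  apply/cvgrPdist_le => e e0.
  have L1 : 0 < L + 1 by rewrite ltr_pwDr.
  have [del del0 Hdel] := segment_unif_continuous (@cY w) (divr_gt0 e0 L1).
  near=> n; rewrite sub0r normrN ger0_norm//; apply: Zle; first exact: ltW.
  move=> i iln; rewrite /h' iln hE indicE.
  case: (boolP (_ \in _)) => [|_]; last by rewrite eqxx.
  rewrite inE => -[NVi NVi1] _.
  have [r /andP[gir rgi] Yr0] : exists2 r, g n i <= r <= g n i.+1 & Y r w = 0.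
    apply: contrapT => nex; apply: NVi1 => r /andP[sr rg].
    have [rgi|gir] := leP r (g n i); first by apply: NVi; rewrite sr.
    by apply/negP => /eqP Yr; apply: nex; exists r => //; rewrite rg ltW.
  rewrite ge_min; apply/orP; right.
  have : `|Y (g n i.+1) w| <= e / (L + 1).
    rewrite -[Y _ w]subr0 -Yr0 ltW//.
    have /andP[sgi _] := gi n i (ltnW iln); have /andP[sg gt'] := gi n i.+1 iln.
    apply: Hdel; first by rewrite sg.
      by rewrite (le_trans sgi)// (le_trans rgi).
    rewrite ger0_norm ?subr_ge0//; apply: (@le_lt_trans _ _ ((t - s) / n.+1%:R)).
      by rewrite -(grid_step s t n i) lerD2l lerN2.
    by near: n; exact: near_grid_step.
  rewrite ler_pdivlMr// mulrC => /(le_trans _); apply.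
  by rewrite ler_wpM2r// lerDl.
have mZ n : measurable_fun setT (Z n).
  apply: measurable_sum_nat => i _; exact: measurable_funM.
have ZC n w : `|Z n w| <= C.
  rewrite ger0_norm//; apply: Zle => // i _ _.
  by rewrite ge_min lexx.
have := @bounded_cvg_Rintegral _ _ _ P Z (cst 0) C mZ ZC Zcvg.
rewrite Rintegral_cst// mul0r => Zto0.
apply/esym/eqP; rewrite -subr_eq0 -normr_le0.
apply: (closed_cvg (fun z => `|\int[P]_w psi (Y t w) -
   \int[P]_w (psi (Y t w) * \1_(NV t) w)| <= z)) Zto0.
- exact: closed_ge.
- exact: nearW.
Unshelve. all: by end_near. Qed.

End reflection.

(** * Reflection of the Gaussian density *)

Section density.
Context d (T : measurableType d) (R : realType).
Variables (mu nu : {measure set T -> \bar R}) (p : T -> R).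
Hypotheses (mp : measurable_fun setT p) (p0 : forall x, 0 <= p x).
Hypothesis nuE : forall A, measurable A -> nu A = (\int[mu]_(x in A) (p x)%:E)%E.
Local Open Scope ereal_scope.
Import HBNNSimple.

Let integral_nnsfun_density (h : {nnsfun T >-> R}) :
  \int[nu]_x (h x)%:E = \int[mu]_x ((h x)%:E * (p x)%:E).
Proof.
transitivity (\sum_(r \in range h) (r%:E * nu (h @^-1` [set r]))).
  under eq_integral do rewrite fimfunE -fsumEFin//.
  rewrite ge0_integral_fsum//; last 2 first.
  - by move=> r; exact/measurable_EFinP/measurable_funM.
  - by move=> r x _; rewrite EFinM nnfun_muleindic_ge0.
  apply: eq_fsbigr => r _; rewrite integralZl_indic_nnsfun// integral_indic//=.
  by rewrite setIT.
under [RHS]eq_integral.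
  move=> x _; rewrite fimfunE -fsumEFin// ge0_mule_fsuml; last first.
    by move=> r; rewrite EFinM nnfun_muleindic_ge0.
  over.
rewrite ge0_integral_fsum//; last 2 first.
- move=> r; apply: emeasurable_funM; last exact/measurable_EFinP.
  exact/measurable_EFinP/measurable_funM.
- move=> r x _; apply: mule_ge0; last by rewrite lee_fin.
  by rewrite EFinM nnfun_muleindic_ge0.
apply: eq_fsbigr => r /set_mem[x _ hx].
have r0 : (0 <= r)%R by rewrite -hx.
under eq_integral do rewrite EFinM -muleA.
rewrite ge0_integralZl//; last 2 first.
- apply: emeasurable_funM; last exact/measurable_EFinP.
  exact/measurable_EFinP/measurable_indic.
- by move=> y _; rewrite mule_ge0// lee_fin.
congr (_ * _); rewrite nuE// [LHS]integral_mkcond; apply: eq_integral => y _.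
by rewrite patchE indicE; case: (_ \in _); rewrite ?mul1e ?mul0e.
Qed.

(** Simple functions first, then monotone convergence on both sides. *)
Lemma ge0_integral_density (f : T -> \bar R) : measurable_fun setT f ->
  (forall x, 0 <= f x) -> \int[nu]_x f x = \int[mu]_x (f x * (p x)%:E).
Proof.
move=> mf f0; pose f_ := nnsfun_approx measurableT mf.
have f_nd x : {homo (fun n => f_ n x) : m n / (m <= n)%N >-> (m <= n)%R}.
  by move=> m n mn; exact/lefP/nd_nnsfun_approx.
have f_f x : (f_ n x)%:E @[n --> \oo] --> f x.
  by apply: cvg_nnsfun_approx => // *; exact: f0.
transitivity (limn (fun n => \int[nu]_x (f_ n x)%:E)).
  rewrite -monotone_convergence//.
  - by apply: eq_integral => x _; apply/esym/cvg_lim => //; exact: f_f.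
  - by move=> n; exact/measurable_EFinP/measurable_funP.
  - by move=> n x _; rewrite lee_fin.
  - by move=> x _ m n mn; rewrite lee_fin; exact: f_nd.
transitivity (limn (fun n => \int[mu]_x ((f_ n x)%:E * (p x)%:E))).
  by congr (limn _); apply/funext => n; exact: integral_nnsfun_density.
rewrite -monotone_convergence//.
- apply: eq_integral => x _; apply/cvg_lim => //.
  by apply: cvgeZr => //; exact: f_f.
- move=> n; apply: emeasurable_funM; last exact/measurable_EFinP.
  exact/measurable_EFinP/measurable_funP.
- by move=> n x _; rewrite mule_ge0// lee_fin.
- move=> x _ m n mn; rewrite lee_wpmul2r ?lee_fin//; exact: f_nd.
Qed.

End density.

Section gaussian.
Context {R : realType}.

Let reflect_at (c : R) : measurableTypeR R -> measurableTypeR R :=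
  fun z : R => c - z.

Let measurable_reflect_at c : measurable_fun setT (reflect_at c).
Proof. by rewrite /reflect_at; exact: measurable_funB. Qed.

HB.instance Definition _ c := isMeasurableFun.Build _ _ _ _ (reflect_at c)
  (measurable_reflect_at c).

(** The reflection turns []a, b]] into [[c - b, c - a[]: the closed end changes side, the length
    does not. *)
Lemma lebesgue_measure_reflect (c : R) (A : set R) : measurable A ->
  pushforward lebesgue_measure (reflect_at c) A =
  lebesgue_measure A.
Proof.
move=> mA; apply/esym.
apply: (@lebesgue_measure_unique R
  (pushforward lebesgue_measure (reflect_at c))) => //= _ [[a b]] _ <-.
rewrite /pushforward/=.
have -> : reflect_at c @^-1` `]a, b] = `[c - b, c - a[%classic.
  by apply/seteqP; split => z /=; rewrite /reflect_at !in_itv/= => /andP[? ?]; lra.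
rewrite !lebesgue_measure_itv/= !lte_fin ltrD2l ltrN2.
case: ifP => // _; rewrite -!EFinB; congr EFin; ring.
Qed.

Lemma ge0_integral_reflect (c : R) (F : R -> \bar R) : measurable_fun setT F ->
  (forall z, 0 <= F z)%E ->
  (\int[lebesgue_measure]_z F (c - z)%R = \int[lebesgue_measure]_z F z)%E.
Proof.
move=> mF F0.
transitivity (\int[pushforward lebesgue_measure (reflect_at c)]_z F z)%E.
  by rewrite ge0_integral_pushforward.
by apply: eq_measure_integral => A mA _; exact: lebesgue_measure_reflect.
Qed.

(** The sole source of the exponential in the theorem. Put [m = x + nu * r]. Exchanging [y] and
    [- y] multiplies the density of [Y] by [exp (- 2 m y / r)], that is
    [exp (- 2 x y / r) * exp (- 2 nu y)], and the last factor cancels against the weight on the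
    left. For [x = 0] no exponential remains on the right, and this is the cancellation behind
    [psiE]. *)
Lemma gaussian_reflection d (T : measurableType d) (P : probability T R)
    (D : T -> R) (r x nu : R) (f : R -> R) :
  0 < r -> measurable_fun setT D ->
  (forall Y, measurable Y -> pushforward P D Y = normal_prob 0 (Num.sqrt r) Y) ->
  measurable_fun setT f -> (forall y, 0 <= f y) ->
  let Y w := x + nu * r + D w in
  \int[P]_w (expR (- (2 * nu * Y w)) * f (- Y w)) =
  \int[P]_w (expR (- (2 / r * x * Y w)) * f (Y w)).
Proof.
move=> r0 mD lawD mf f0 Y; rewrite /Rintegral; congr fine.
pose m := x + nu * r.
pose F1 z := expR (- (2 * nu * (m + z))) * f (- (m + z)).
pose F2 z := expR (- (2 / r * x * (m + z))) * f (m + z).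
have mmz : measurable_fun setT (fun z : R => m + z) by exact: measurable_funD.
have mE k : measurable_fun setT (fun z : R => expR (- (k * (m + z)))).
  apply: measurableT_comp => //; apply: measurableT_comp => //.
  exact: measurable_funM.
have mF1 : measurable_fun setT F1.
  apply: measurable_funM; first exact: mE.
  apply: measurableT_comp => //; exact: measurableT_comp.
have mF2 : measurable_fun setT F2.
  apply: measurable_funM; first exact: mE.
  exact: measurableT_comp.
pose s := Num.sqrt r.
have s0 : s != 0 by rewrite gt_eqF// sqrtr_gt0.
have mD' : measurable_fun setT (D : T -> measurableTypeR R) by [].
pose mfD := HB.pack_for {mfun T >-> measurableTypeR R} (D : T -> measurableTypeR R)
  (isMeasurableFun.Build _ _ _ _ _ mD').
have push (F : R -> R) : measurable_fun setT F -> (forall z, 0 <= F z) ->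
   (\int[P]_w (F (D w))%:E =
    \int[lebesgue_measure]_z ((F z)%:E * (normal_pdf 0 s z)%:E))%E.
  move=> mF F0.
  transitivity (\int[pushforward P mfD]_z (F z)%:E)%E.
    rewrite ge0_integral_pushforward//; first exact/measurable_EFinP.
    by move=> z _; rewrite lee_fin.
  transitivity (\int[normal_prob 0 s]_z (F z)%:E)%E.
    by apply: (@eq_measure_integral _ _ _ _ (normal_prob 0 s)) => A mA _; exact: lawD.
  apply: (@ge0_integral_density _ (measurableTypeR R) R lebesgue_measure
    (normal_prob 0 s) (normal_pdf 0 s) _ _ _ (EFin \o F)) => //.
  - exact: measurable_normal_pdf.
  - exact: normal_pdf_ge0.
  - exact/measurable_EFinP.
have F10 z : 0 <= F1 z by rewrite mulr_ge0// expR_ge0.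
have F20 z : 0 <= F2 z by rewrite mulr_ge0// expR_ge0.
(* Reflecting about [- m] sends [m + z] to its opposite. *)
rewrite (push F1)// (push F2)// -(ge0_integral_reflect (- (2 * m))); last 2 first.
- apply: emeasurable_funM; apply/measurable_EFinP => //.
  exact: measurable_normal_pdf.
- by move=> z; rewrite mule_ge0 ?lee_fin// normal_pdf_ge0.
apply: eq_integral => z _; rewrite -!EFinM; congr EFin.
rewrite /F1 /F2 !normal_pdfE// /normal_fun.
have -> : - (m + (- (2 * m) - z)) = m + z by ring.
rewrite mulrAC [RHS]mulrAC; congr (_ * _).
rewrite mulrCA [RHS]mulrCA; congr (_ * _).
rewrite -!expRD; congr expR.
rewrite /s sqr_sqrtr ?ltW// /m; field.
by rewrite gt_eqF.
Qed.

End gaussian.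

(** * Law of the restarted path *)

Section bump.
Context {R : realType}.
Implicit Types (a b c e y z : R).

Lemma dist_min a b a' b' e : `|a - a'| <= e -> `|b - b'| <= e ->
  `|Num.min a b - Num.min a' b'| <= e.
Proof.
rewrite !ler_norml => /andP[h1 h2] /andP[h3 h4].
by case: (leP a b) => ?; case: (leP a' b') => ?; apply/andP; split; lra.
Qed.

Lemma dist_max0 a a' : `|Num.max 0 a - Num.max 0 a'| <= `|a - a'|.
Proof.
have [] : `|a - a'| <= `|a - a'| by [].
rewrite ler_norml => /andP[h1 h2]; rewrite ler_norml.
by case: (leP 0 a) => ?; case: (leP 0 a') => ?; apply/andP; split; lra.
Qed.

(* Lipschitz functions with bounded support that increase to the indicator of
   [dd > 0]. *)
Definition bump (dd : R -> R) (n : nat) y : R :=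
  Num.min 1 (n%:R * Num.max 0 (Num.min (dd y) (n%:R - `|y|))).

Lemma bump_ge0 dd n y : 0 <= bump dd n y.
Proof. by rewrite le_min ler01 mulr_ge0// le_max lexx. Qed.

Lemma bump_le1 dd n y : bump dd n y <= 1.
Proof. by rewrite ge_min lexx. Qed.

Lemma bump_supp dd n y : bump dd n y != 0 -> 0 < dd y /\ `|y| <= n%:R.
Proof.
rewrite /bump; case: (leP (Num.min (dd y) (n%:R - `|y|)) 0) => [_|].
  by rewrite mulr0 min_r ?ler01// eqxx.
rewrite lt_min subr_gt0 => /andP[? ?] _; split => //; exact: ltW.
Qed.

Lemma bump_lip dd n : (forall y z, `|dd y - dd z| <= `|y - z|) ->
  forall y z, `|bump dd n y - bump dd n z| <= n%:R * `|y - z|.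
Proof.
move=> ddL y z; apply: dist_min; first by rewrite subrr normr0 mulr_ge0.
rewrite -mulrBr normrM (ger0_norm (ler0n _ _)) ler_wpM2l//.
apply: (le_trans (dist_max0 _ _)); apply: dist_min => //.
have -> : n%:R - `|y| - (n%:R - `|z|) = `|z| - `|y| by ring.
by rewrite distrC; exact: ler_dist_dist.
Qed.

Lemma bump_cvg dd y : bump dd n y @[n --> \oo] --> ((0 < dd y)%R%:R : R).
Proof.
have [dy|dy] := ltP 0 (dd y); last first.
  apply: cvg_near_cst; apply: nearW => n; apply/eqP/contraT => /bump_supp[].
  by rewrite ltNge dy.
apply: cvg_near_cst; near=> n; apply: min_l.
have n1 : 1 <= n%:R :> R by rewrite ler1n; near: n; exact: nbhs_infty_gt.
have nd : (dd y)^-1 <= n%:R by near: n; exact: nbhs_infty_ger.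
have ny : `|y| + 1 <= n%:R by near: n; exact: nbhs_infty_ger.
(* As [n - |y| >= 1], the cut-off of the support can lower [dd y] at most to 1. *)
apply: (@le_trans _ _ (n%:R * Num.min (dd y) 1)).
  case: (leP (dd y) 1) => _; last by rewrite mulr1.
  by rewrite -ler_pdivrMr// mul1r.
rewrite ler_wpM2l// le_max; apply/orP; right.
by rewrite le_min !ge_min lexx/=; apply/orP; right; lra.
Unshelve. all: by end_near. Qed.

(** Factor out the larger exponential and use [1 - exp (- a) <= a]. *)
Lemma expR_dist (p q M : R) : expR p <= M -> expR q <= M ->
  `|expR p - expR q| <= M * `|p - q|.
Proof.
wlog qp : p q / q <= p => [H pM qM|pM qM].
  have [qp|/ltW pq] := leP q p; first exact: H.
  by rewrite distrC (distrC p); exact: H.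
rewrite ger0_norm ?subr_ge0 ?ler_expR// ger0_norm ?subr_ge0//.
apply: (@le_trans _ _ (expR p * (p - q))); last by rewrite ler_wpM2r// subr_ge0.
have -> : expR p - expR q = expR p * (1 - expR (q - p)).
  by rewrite mulrBr mulr1 -expRD (addrC p) subrK.
rewrite ler_wpM2l ?expR_ge0//; have := expR_ge1Dx (q - p); lra.
Qed.

Section exp_weight.
Variables (g : R -> R) (c K L : R).
Hypotheses (g0 : forall y, 0 <= g y) (g1 : forall y, g y <= 1).
Hypothesis gK : forall y, g y != 0 -> `|y| <= K.
Hypothesis gL : forall y z, `|g y - g z| <= L * `|y - z|.

Let E := expR (`|c| * K).

Let expK y : `|y| <= K -> expR (- (c * y)) <= E.
Proof.
move=> yK; rewrite ler_expR; apply: (@le_trans _ _ `|c * y|).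
  by rewrite -normrN ler_norm.
by rewrite normrM ler_wpM2l.
Qed.

Lemma exp_weight_bounded y : `|expR (- (c * y)) * g y| <= E.
Proof.
have [->|gy] := eqVneq (g y) 0; first by rewrite mulr0 normr0 expR_ge0.
rewrite ger0_norm ?mulr_ge0 ?expR_ge0//.
by rewrite -[leRHS]mulr1 ler_pM ?expR_ge0// expK// gK.
Qed.

(** If both points are outside the support the difference is 0, so by symmetry [|y| <= K]. The
    difference is then split so that the variation of the exponential is multiplied by [g z], and
    matters only when [z] is in the range where the exponential is at most [E]. *)
Lemma exp_weight_lip y z :
  `|expR (- (c * y)) * g y - expR (- (c * z)) * g z| <=
  E * (L + `|c|) * `|y - z|.
Proof.
have E0 : 0 <= E by exact: expR_ge0.
have L0 : 0 <= L by have := gL 1 0; rewrite subr0 normr1 mulr1; exact: le_trans.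
wlog yK : y z / `|y| <= K => [H|].
  have [/H//|yK] := leP `|y| K.
  have [zK|zK] := leP `|z| K; first by rewrite distrC (distrC y); exact: H.
  have g0' x : K < `|x| -> g x = 0.
    by move=> xK; apply/eqP/contraT => /gK; rewrite leNgt xK.
  by rewrite (g0' y)// (g0' z)// !mulr0 subrr normr0 !mulr_ge0// addr_ge0.
have -> : expR (- (c * y)) * g y - expR (- (c * z)) * g z =
  expR (- (c * y)) * (g y - g z) + g z * (expR (- (c * y)) - expR (- (c * z))).
  by ring.
have -> : E * (L + `|c|) * `|y - z| = E * L * `|y - z| + E * `|c| * `|y - z|.
  by ring.
apply: (le_trans (ler_normD _ _)); apply: lerD.
  rewrite normrM (ger0_norm (expR_ge0 _)) -mulrA ler_pM ?expR_ge0//.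
  exact: expK.
have [->|gz] := eqVneq (g z) 0; first by rewrite mul0r normr0 !mulr_ge0.
rewrite normrM (ger0_norm (g0 _)); apply: (@le_trans _ _ (1 * (E * `|c * (y - z)|))).
  rewrite ler_pM//; apply: le_trans (expR_dist (expK yK) (expK (gK gz))) _.
  by rewrite (_ : - (c * y) - - (c * z) = - (c * (y - z))) ?normrN//; ring.
by rewrite mul1r normrM mulrA.
Qed.

End exp_weight.
End bump.

Lemma nonvanishing_sign (R : realType) (f : R -> R) (a b : R) : a <= b ->
  {within `[a, b], continuous f} -> (forall u, a <= u <= b -> f u != 0) ->
  0 < f a * f b.
Proof.
move=> ab cf f0; rewrite ltNge; apply/negP => fab.
have fa0 : f a != 0 by apply: f0; rewrite lexx.
have fb0 : f b != 0 by apply: f0; rewrite lexx andbT.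
have : Num.min (f a) (f b) <= 0 <= Num.max (f a) (f b).
  have [fa|fa] := leP (f a) 0.
    have fa' : f a < 0 by rewrite lt_neqAle fa0.
    by move: fab; rewrite nmulr_rle0// => fb; rewrite ge_min fa le_max fb orbT.
  by move: fab; rewrite pmulr_rle0// => fb; rewrite ge_min fb orbT le_max ltW.
move=> /(IVT ab cf)[u]; rewrite in_itv/= => uab fu0.
by have := f0 u uab; rewrite fu0 eqxx.
Qed.

Section nonvanishing_oc.
Context d (S : measurableType d) (R : realType).

(** The first grid points [a + (b - a) / n.+1] decrease to [a], which reduces the claim to countably
    many closed intervals. *)
Lemma measurable_nonvanishing_oc (f : R -> S -> R) (a b : R) : a < b ->
  (forall u, a <= u <= b -> measurable_fun setT (f u)) ->
  (forall p, {within `[a, b], continuous (f ^~ p)}) ->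
  measurable (nonvanishing_oc f a b).
Proof.
move=> ab mf cf.
have gab n : a < grid a b n 1 <= b.
  have /andP[_ ->] := @grid_itv R a b n 1 (ltW ab) isT; rewrite andbT.
  by rewrite /grid ltrDl mulr_gt0 ?subr_gt0// divr_gt0.
have -> : nonvanishing_oc f a b = \bigcap_n nonvanishing f (grid a b n 1) b.
  apply/seteqP; split => p nv.
    move=> n _ u /andP[gu ub]; apply: nv; rewrite ub andbT.
    by apply: lt_le_trans gu; have /andP[] := gab n.
  move=> u /andP[au ub].
  have ua0 : 0 < u - a by rewrite subr_gt0.
  have [n _ /(_ n (leqnn _))/= nu] := near_grid_step a b ua0.
  apply: (nv n I); rewrite ub andbT.
  have gs := grid_step a b n 0; rewrite grid0 in gs.
  by rewrite -(lerD2r (- a)) gs ltW.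
apply: bigcapT_measurable => n; have /andP[ag gb] := gab n.
apply: measurable_nonvanishing => // [u /andP[gu ub]|p].
  by apply: mf; rewrite ub (le_trans (ltW ag)).
have sub : `[grid a b n 1, b]%classic `<=` `[a, b]%classic.
  move=> u /=; rewrite !in_itv/= => /andP[gu ->]; rewrite andbT.
  exact: le_trans (ltW ag) gu.
exact: (continuous_subspaceW sub (cf p)).
Qed.

End nonvanishing_oc.

(** As [h] has no sign, uniqueness of measures does not apply directly. The sets [D] with zero
    integral form a Dynkin class, and the open rays a pi-system inside it. *)
Lemma Rintegral_preimage_eq0 d (T : measurableType d) (R : realType)
    (P : probability T R) (V h : T -> R) (M : R) :
  measurable_fun setT V -> measurable_fun setT h -> (forall w, `|h w| <= M) ->
  \int[P]_w h w = 0 ->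
  (forall c, \int[P]_w (\1_(`]c, +oo[%classic : set R) (V w) * h w) = 0) ->
  forall D, measurable D -> \int[P]_w (\1_D (V w) * h w) = 0.
Proof.
move=> mV mh hM h0 hc D mD.
have m1 D' : measurable D' -> measurable_fun setT (fun w => \1_D' (V w) * h w).
  move=> mD'; apply: measurable_funM => //.
  by apply: measurableT_comp => //; exact/measurable_indicP.
have b1 D' w : `|\1_D' (V w) * h w| <= M.
  rewrite normrM indicE; apply: le_trans (hM w).
  by rewrite ler_piMl//; case: (_ \in _); rewrite ?normr1 ?normr0.
have int1 D' : measurable D' -> P.-integrable setT (EFin \o (fun w => \1_D' (V w) * h w)).
  by move=> mD'; apply: (@bounded_integrable _ _ _ _ _ M) => //; exact: m1.
have inth : P.-integrable setT (EFin \o h) by exact: (@bounded_integrable _ _ _ _ _ M).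
have sD : (@RGenOInfty.G R).-sigma.-measurable D by rewrite -RGenOInfty.measurableE.
apply: (@dynkin_induction _ (measurableTypeR R) (@RGenOInfty.G R)
  (fun D => \int[P]_w (\1_D (V w) * h w) = 0) _ _ _ _ _ _ D sD).
- exact: RGenOInfty.measurableE.
- move=> _ _ [x ->] [y ->]; exists (Num.max x y).
  apply/seteqP; split => z /=; rewrite !in_itv/= !andbT gt_max.
    by move=> [-> ->].
  by move=> /andP[-> ->].
- rewrite -[RHS]h0; apply: eq_Rintegral => w _.
  by rewrite indicT mul1r.
- by move=> _ [c ->]; exact: hc.
- move=> S mS S0; rewrite (_ : (fun w => _) = (fun w => h w - \1_S (V w) * h w)).
    by rewrite RintegralB// ?h0 ?S0 ?subrr//; exact: int1.
  apply/funext => w; rewrite !indicE in_setC.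
  by case: (V w \in S); rewrite /= ?mul0r ?mul1r ?subrr ?subr0.
- move=> F mF tF F0.
  (* By disjointness at most one term of the partial sum is nonzero, so it is bounded by [M] and
     eventually constant in [n]. *)
  pose G n w := \sum_(0 <= k < n) (\1_(F k) (V w) * h w).
  have mG n : measurable_fun setT (G n).
    by apply: measurable_sum_nat => i _; apply: m1; exact: mF.
  have GE w k0 : F k0 (V w) -> forall n, G n w = (k0 < n)%N%:R * h w.
    move=> Fk0 n; rewrite /G -mulr_suml; congr (_ * _).
    have FE k : \1_(F k) (V w) = (k == k0)%:R :> R.
      rewrite indicE; congr (_%:R); congr nat_of_bool.
      apply/idP/eqP => [/set_mem Fk|->]; last exact: mem_set.
      by apply: tF => //; exists (V w).
    elim: n => [|n IH]; first by rewrite big_nil.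
    rewrite big_nat_recr//= IH FE ltnS (leq_eqVlt k0) (eq_sym n).
    by case: eqVneq => [->|_]; rewrite ?ltnn ?add0r ?addr0.
  have GN w : ~ (\bigcup_k F k) (V w) -> forall n, G n w = 0.
    move=> nF n; rewrite /G big1_seq// => k _.
    by rewrite indicE memNset ?mul0r// => Fk; apply: nF; exists k.
  have GM n w : `|G n w| <= M.
    have [[k _ Fk]|nF] := pselect ((\bigcup_k F k) (V w)); last first.
      by rewrite GN// normr0 (le_trans _ (hM w)).
    rewrite (GE _ _ Fk) normrM (le_trans _ (hM w))// ler_piMl//.
    by case: (_ < _)%N; rewrite ?normr1 ?normr0.
  have Gcvg w : G ^~ w @ \oo --> \1_(\bigcup_k F k) (V w) * h w.
    have [FV|nF] := pselect ((\bigcup_k F k) (V w)); last first.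
      rewrite indicE memNset// mul0r; apply: cvg_near_cst.
      by apply: nearW => n; exact: GN.
    rewrite indicE mem_set//; case: FV => k _ Fk.
    apply: cvg_near_cst; near=> n; rewrite (GE _ _ Fk).
    by rewrite (_ : (k < n)%N)//; near: n; exact: nbhs_infty_gt.
  have /cvg_lim <- // := bounded_cvg_Rintegral (P := P) mG GM Gcvg.
  rewrite (_ : (fun n => _) = cst 0) ?lim_cst//.
  apply/funext => n; rewrite /G Rintegral_sum; last first.
    by move=> k; apply: int1; exact: mF.
  by rewrite big1_seq// => k _; exact: F0.
Unshelve. all: by end_near. Qed.

Section bridge.
Context d (T : measurableType d) (R : realType) (P : probability T R).
Variables (B : R -> {RV P >-> R}) (nu s t : R).
Hypotheses (BM : brownian_motion B) (s0 : 0 <= s) (st : s < t).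

(** The path of the overview with its value at [s] frozen to [x]; it involves [B] only through
    increments from time [s]. *)
Definition restarted (x u : R) (w : T) : R := x + (B u w - B s w) + nu * (u - s).

(** The probability that a Brownian bridge of duration [t - s] from [x] to [y] avoids 0. The drift
    is absent, as it does not affect bridges. *)
Definition no_hit_prob (x y : R) : R :=
  Num.max (1 - expR (- (2 / (t - s) * x * y))) 0.

Lemma measurable_restarted x u : measurable_fun setT (restarted x u).
Proof.
apply: measurable_funD => //; apply: measurable_funD => //.
exact: measurable_funB.
Qed.

Lemma restarted_continuous x w : {within `[s, t], continuous (restarted x ^~ w)}.
Proof.
have cB : {within `[s, t], continuous (fun u => B u w)}.
  have sub : `[s, t]%classic `<=` `[0, +oo[%classic.
    move=> u /=; rewrite !in_itv/= andbT => /andP[su _].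
    exact: le_trans su.
  exact: (continuous_subspaceW sub (@bm_continuous _ _ _ _ _ BM w)).
have cl : {within `[s, t], continuous (fun u : R => x - B s w + nu * (u - s))}.
  apply: continuous_subspaceT => u; apply: cvgD; first exact: cvg_cst.
  by apply: cvgM; [exact: cvg_cst|apply: cvgB; [exact: cvg_id|exact: cvg_cst]].
rewrite (_ : restarted x ^~ w = (fun u => B u w) \+
    (fun u => x - B s w + nu * (u - s))); first exact: within_continuousD.
by apply/funext => u /=; rewrite /restarted; ring.
Qed.

Lemma restarted_start x w : restarted x s w = x.
Proof. by rewrite /restarted !subrr mulr0 !addr0. Qed.

Lemma no_hit_prob_ge0 x y : 0 <= no_hit_prob x y.
Proof. by rewrite le_max lexx orbT. Qed.

Lemma no_hit_prob_le1 x y : no_hit_prob x y <= 1.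
Proof. by rewrite ge_max ler01 andbT gerBl expR_ge0. Qed.

Lemma no_hit_prob_eq0 x y : x * y <= 0 -> no_hit_prob x y = 0.
Proof.
move=> xy; apply: max_r; rewrite subr_le0 -[leLHS]expR0 ler_expR.
by rewrite oppr_ge0 -mulrA pmulr_rle0// divr_gt0// subr_gt0.
Qed.

Lemma no_hit_probE x y : 0 < x * y ->
  no_hit_prob x y = 1 - expR (- (2 / (t - s) * x * y)).
Proof.
move=> xy; apply: max_l; rewrite subr_ge0 -[leRHS]expR0 ler_expR.
by rewrite oppr_le0 -mulrA mulr_ge0// ?(ltW xy)// ltW// divr_gt0// subr_gt0.
Qed.

Lemma measurable_no_hit_prob d' (S : measurableType d') (f g : S -> R) :
  measurable_fun setT f -> measurable_fun setT g ->
  measurable_fun setT (fun w => no_hit_prob (f w) (g w)).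
Proof.
move=> mf mg; apply: measurable_maxr => //; apply: measurable_funB => //.
apply: measurableT_comp => //; apply: measurableT_comp => //.
by apply: measurable_funM => //; exact: measurable_funM.
Qed.

Lemma restarted_no_hit_sign x w : nonvanishing (restarted x) s t w ->
  0 < x * restarted x t w.
Proof.
move=> nv; rewrite -{1}(restarted_start x w).
by apply: (nonvanishing_sign (ltW st) (@restarted_continuous x w)).
Qed.

(** An instance of [outer_inner_indep] with [u] in place of [r]: the past of [u] is outer and the
    increment over [[u, t]] is inner. *)
Lemma restarted_indep x u : s <= u -> u < t -> forall A D,
  <<s gen_family [set v | s <= v <= u] (restarted x) >> A -> measurable D ->
  (P (A `&` [set w | D (restarted x t w - restarted x u w)%R]) =
   P A * P [set w | D (restarted x t w - restarted x u w)%R])%E.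
Proof.
move=> su ut A D sA mD.
have u0 : 0 <= u by exact: le_trans su.
apply: (outer_inner_indep BM u0 ut).
  apply: sub_g_sigma_family sA => v /andP[sv vu].
  have mB r : 0 <= r -> r <= u -> measurable_fun
      [set: g_sigma_algebraType (gen_family (outer_idx u t) (outer_var B u t))]
      (B r : g_sigma_algebraType (gen_family (outer_idx u t) (outer_var B u t)) -> R).
    move=> r0 ru.
    have := @measurable_gen_family _ T R _ (outer_idx u t) (outer_var B u t) r.
    by rewrite /outer_var ru; apply; left; rewrite r0.
  apply: measurable_funD => //; apply: measurable_funD => //.
  by apply: measurable_funB; apply: mB => //; rewrite (le_trans s0).
have mI : measurable_fun
    [set: g_sigma_algebraType (gen_family (inner_idx u t) (inner_var B u))]
    ((fun w => restarted x t w - restarted x u w) :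
      g_sigma_algebraType (gen_family (inner_idx u t) (inner_var B u)) -> R).
  have : measurable_fun
    [set: g_sigma_algebraType (gen_family (inner_idx u t) (inner_var B u))]
    ((fun w => inner_var B u t w + nu * (t - u)) :
      g_sigma_algebraType (gen_family (inner_idx u t) (inner_var B u)) -> R).
    apply: measurable_funD => //; apply: measurable_gen_family => /=.
    by rewrite /inner_idx/= lexx ltW.
  by apply: eq_measurable_fun => w _; rewrite /inner_var/restarted/=; ring.
by have := mI measurableT D mD; rewrite setTI.
Qed.

Lemma restarted_gaussian_reflection u y (f : R -> R) : s <= u -> u < t ->
  measurable_fun setT f -> (forall z, 0 <= f z) ->
  let Y w := y + nu * (t - u) + (B t w - B u w) in
  \int[P]_w (expR (- (2 * nu * Y w)) * f (- Y w)) =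
  \int[P]_w (expR (- (2 / (t - u) * y * Y w)) * f (Y w)).
Proof.
move=> su ut mf f0.
apply: (@gaussian_reflection R d T P (B t \- B u) (t - u) y nu f) => //.
- by rewrite subr_gt0.
- by move=> Y mY; rewrite (bm_gauss BM)// (le_trans s0).
Qed.

(** The hypothesis on [dd] confines the bump to the side of [x], where its mirror image vanishes and
    where [no_hit_prob] needs no truncation at 0. *)
Lemma bump_no_hit x (dd : R -> R) n : x != 0 ->
  (forall y z, `|dd y - dd z| <= `|y - z|) ->
  (forall y, 0 < dd y -> 0 < x * y) ->
  \int[P]_w (bump dd n (restarted x t w) * \1_(nonvanishing (restarted x) s t) w) =
  \int[P]_w (bump dd n (restarted x t w) * no_hit_prob x (restarted x t w)).
Proof.
move=> x0 ddL ddx.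
pose psi0 := bump dd n.
pose psi1 y := expR (- (2 * nu * y)) * psi0 (- y).
pose psi y := psi0 y - psi1 y.
pose K : R := n%:R.
have L0 := bump_lip n ddL.
have supp1 y : psi0 (- y) != 0 -> `|y| <= K by move=> /bump_supp[_]; rewrite normrN.
have lip1 y z : `|psi0 (- y) - psi0 (- z)| <= K * `|y - z|.
  by rewrite (le_trans (L0 _ _))// -opprD normrN.
pose E := expR (`|2 * nu| * K).
have psi1E y : `|psi1 y| <= E.
  exact: (@exp_weight_bounded R (psi0 \o -%R) (2 * nu) K
    (fun z => bump_ge0 dd n (- z)) (fun z => bump_le1 dd n (- z)) supp1).
have psi1L y z : `|psi1 y - psi1 z| <= E * (K + `|2 * nu|) * `|y - z|.
  exact: (@exp_weight_lip R (psi0 \o -%R) (2 * nu) K K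
    (fun z => bump_ge0 dd n (- z)) (fun z => bump_le1 dd n (- z)) supp1 lip1).
have psi0E y : `|psi0 y| <= 1 by rewrite ger0_norm ?bump_le1// bump_ge0.
have psiE y : `|psi y| <= 1 + E by rewrite (le_trans (ler_normB _ _))// lerD.
have psiL y z : `|psi y - psi z| <= (K + E * (K + `|2 * nu|)) * `|y - z|.
  have -> : psi y - psi z = (psi0 y - psi0 z) - (psi1 y - psi1 z).
    by rewrite /psi; ring.
  by rewrite mulrDl (le_trans (ler_normB _ _))// lerD// L0.
have mpsi0 : measurable_fun setT psi0 := lipschitz_measurable L0.
have mpsi1 : measurable_fun setT psi1 := lipschitz_measurable psi1L.
have mY u : measurable_fun setT (restarted x u) := measurable_restarted x u.
have mpsiY : measurable_fun setT (fun w => psi0 (restarted x t w)).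
  exact: measurableT_comp.
have int0 (V : T -> R) : measurable_fun setT V ->
    P.-integrable setT (EFin \o (fun w => psi0 (V w))).
  move=> mV; apply: (@bounded_integrable _ _ _ _ _ 1) => //.
  exact: measurableT_comp.
have int1 (V : T -> R) : measurable_fun setT V ->
    P.-integrable setT (EFin \o (fun w => psi1 (V w))).
  move=> mV; apply: (@bounded_integrable _ _ _ _ _ E) => //.
  exact: measurableT_comp.
(* Used twice: with [y = 0] the two terms cancel, which is the hypothesis [psiE] of [reflection];
   with [u = s] and [y = x] their difference is the desired right-hand side. *)
have psi_refl u y : s <= u -> u < t ->
    let Y w := y + nu * (t - u) + (B t w - B u w) in
    \int[P]_w psi (Y w) =
    \int[P]_w psi0 (Y w) - \int[P]_w (expR (- (2 / (t - u) * y * Y w)) * psi0 (Y w)).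
  move=> su ut Y.
  have mYy : measurable_fun setT Y.
    by apply: measurable_funD => //; exact: measurable_funB.
  rewrite RintegralB//; [|exact: int0|exact: int1]; congr (_ - _).
  by apply: (restarted_gaussian_reflection y su ut) => //; exact: bump_ge0.
have YtE w : restarted x t w = x + nu * (t - s) + (B t w - B s w).
  by rewrite /restarted; ring.
have := @reflection _ T R P (restarted x) s t x psi (1 + E) (K + E * (K + `|2 * nu|))
  st x0 mY (restarted_start x) (@restarted_continuous x) (@restarted_indep x) psiE psiL.
have psi00 : psi 0 = 0 by rewrite /psi /psi1 mulr0 !oppr0 expR0 mul1r subrr.
move=> /(_ psi00) reflY.
have {reflY} : \int[P]_w (psi (restarted x t w) * \1_(nonvanishing (restarted x) s t) w) =
    \int[P]_w psi (restarted x t w).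
  apply: reflY => u su ut.
  transitivity (\int[P]_w psi (0 + nu * (t - u) + (B t w - B u w))).
    by apply: eq_Rintegral => w _; congr psi; rewrite /restarted; ring.
  rewrite psi_refl//.
  rewrite [X in _ - X](_ : _ = \int[P]_w psi0 (0 + nu * (t - u) + (B t w - B u w))).
    by rewrite subrr.
  by apply: eq_Rintegral => w _; rewrite mulr0 mul0r oppr0 expR0 mul1r.
have -> : \int[P]_w psi (restarted x t w) =
    \int[P]_w (psi0 (restarted x t w) * no_hit_prob x (restarted x t w)).
  under eq_Rintegral do rewrite YtE.
  rewrite psi_refl//.
  under [X in X - _]eq_Rintegral do rewrite -YtE.
  under [X in _ - X]eq_Rintegral do rewrite -YtE.
  rewrite -RintegralB//; last 2 first.
    exact: int0.
    apply: (@bounded_integrable _ _ _ _ _ (expR (`|2 / (t - s) * x| * K))).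
      apply: measurable_funM => //; apply: measurableT_comp => //.
      by apply: measurableT_comp => //; exact: measurable_funM.
    move=> w; apply: (@exp_weight_bounded R psi0) => [z|z|z].
    - exact: bump_ge0.
    - exact: bump_le1.
    - by move=> /bump_supp[].
  apply: eq_Rintegral => w _.
  have [->|p0] := eqVneq (psi0 (restarted x t w)) 0; first by rewrite mulr0 subrr mul0r.
  rewrite no_hit_probE; first by ring.
  by apply: ddx; have [] := bump_supp p0.
move=> <-; apply: eq_Rintegral => w _.
rewrite indicE; case: (boolP (w \in _)) => [|_]; last by rewrite !mulr0.
rewrite inE => /restarted_no_hit_sign xY.
suff -> : psi (restarted x t w) = psi0 (restarted x t w) by [].
(* Without a zero [X_t] has the sign of [x], so [- X_t] is outside the support of [psi0]. *)
rewrite /psi /psi1; have [->|/bump_supp[/ddx]] := eqVneq (psi0 (- restarted x t w)) 0.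
  by rewrite mulr0 subr0.
by rewrite mulrN oppr_gt0 ltNge ltW.
Qed.

Let mN x : measurable (nonvanishing (restarted x) s t).
Proof.
apply: measurable_nonvanishing => [|u _|]; first exact: ltW.
  exact: measurable_restarted.
exact: restarted_continuous.
Qed.

(** The difference [h] of the two integrands, apart from the indicator of [D], vanishes where
    [x * X_t <= 0]. Only the side of [x] matters, and there the indicators of open rays are limits
    of bumps, so [Rintegral_preimage_eq0] applies. *)
Lemma no_hit_law_neq0 x (D : set R) : x != 0 -> measurable D ->
  \int[P]_w (\1_D (restarted x t w) * \1_(nonvanishing (restarted x) s t) w) =
  \int[P]_w (\1_D (restarted x t w) * no_hit_prob x (restarted x t w)).
Proof.
move=> x0 mD; pose V := restarted x t; pose N := nonvanishing (restarted x) s t.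
have mV : measurable_fun setT V := measurable_restarted x t.
have m1 : measurable_fun setT (\1_N : T -> R).
  by apply/measurable_indicP; exact: mN.
have mF : measurable_fun setT (fun w => no_hit_prob x (V w)).
  exact: measurable_no_hit_prob.
have mD1 : measurable_fun setT (fun w => \1_D (V w) : R).
  by apply: measurableT_comp => //; exact/measurable_indicP.
have indic01 (S : Type) (A : set S) z : 0 <= (\1_A z : R) <= 1.
  by rewrite indicE; case: (_ \in _); rewrite lexx ler01.
have F01 w : 0 <= no_hit_prob x (V w) <= 1.
  by rewrite no_hit_prob_ge0 no_hit_prob_le1.
have bnd (a b : R) : 0 <= a <= 1 -> 0 <= b <= 1 -> `|a * b| <= 1.
  by move=> /andP[? ?] /andP[? ?]; rewrite ger0_norm ?mulr_ge0// mulr_ile1.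
pose h w := \1_N w - no_hit_prob x (V w).
have mh : measurable_fun setT h by exact: measurable_funB.
have h1 w : `|h w| <= 1.
  have /andP[? ?] := indic01 _ N w; have /andP[? ?] := F01 w.
  by rewrite /h ler_norml; apply/andP; split; lra.
have hx w : ~~ (0 < x * V w) -> h w = 0.
  move=> xV; rewrite /h indicE memNset; last first.
    by move=> /restarted_no_hit_sign; apply/negP.
  by rewrite no_hit_prob_eq0 ?subrr// leNgt.
have dd0 (dd : R -> R) : (forall y z, `|dd y - dd z| <= `|y - z|) ->
    (forall y, 0 < dd y -> 0 < x * y) ->
    \int[P]_w ((0 < dd (V w))%R%:R * h w) = 0.
  move=> ddL ddx.
  have mb n : measurable_fun setT (fun w => bump dd n (V w)).
    by apply: measurableT_comp => //; exact: lipschitz_measurable (bump_lip n ddL).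
  have b01 n w : 0 <= bump dd n (V w) <= 1 by rewrite bump_ge0 bump_le1.
  have := @bounded_cvg_Rintegral _ _ _ P (fun n w => bump dd n (V w) * h w)
    (fun w => (0 < dd (V w))%R%:R * h w) 1.
  move=> /(_ _ _ _)/cvg_lim <- //.
  - rewrite (_ : (fun n => _) = cst 0) ?lim_cst//; apply/funext => n.
    rewrite /h; under eq_Rintegral do rewrite mulrBr.
    rewrite RintegralB//.
    + by rewrite bump_no_hit// subrr.
    + apply: (@bounded_integrable _ _ _ _ _ 1); first exact: measurable_funM.
      by move=> w; exact: bnd.
    + apply: (@bounded_integrable _ _ _ _ _ 1); first exact: measurable_funM.
      by move=> w; exact: bnd.
  - by move=> n; exact: measurable_funM.
  - move=> n w; rewrite normrM -[leRHS]mulr1 ler_pM//.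
    by rewrite ger0_norm ?bump_le1// bump_ge0.
  - by move=> w; apply: cvgM; [exact: bump_cvg|exact: cvg_cst].
(* A function with the sign of [x * y] and Lipschitz constant 1, as [bump_lip] requires. *)
pose sx (y : R) := if 0 < x then y else - y.
have sxE y : (0 < sx y) = (0 < x * y).
  rewrite /sx; case: ifPn => x_gt0; first by rewrite pmulr_rgt0.
  have xlt0 : x < 0 by rewrite lt_neqAle x0 leNgt.
  by rewrite nmulr_rgt0// oppr_gt0.
have sxL y z : `|sx y - sx z| <= `|y - z|.
  by rewrite /sx; case: ifP => // _; rewrite -opprD normrN.
have H : \int[P]_w (\1_D (V w) * h w) = 0.
  apply: (@Rintegral_preimage_eq0 _ _ _ P V h 1) => //.
    rewrite -[RHS](dd0 sx)//; last by move=> y; rewrite sxE.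
    apply: eq_Rintegral => w _; rewrite sxE.
    by case: (boolP (0 < x * V w)) => [_|/hx ->]; rewrite ?mul1r ?mulr0.
  (* This minimum is positive exactly on the part of the ray on the side of [x]; by [hx] the rest
     contributes nothing. *)
  move=> c; rewrite -[RHS](dd0 (fun y => Num.min (y - c) (sx y))).
  - apply: eq_Rintegral => w _; rewrite lt_min sxE subr_gt0.
    case: (boolP (0 < x * V w)) => [_|/hx ->]; last by rewrite !mulr0.
    rewrite andbT indicE; congr (_%:R * _); congr nat_of_bool.
    by apply/idP/idP; rewrite inE/= in_itv/= andbT.
  - move=> y z; apply: dist_min => //.
    by rewrite (_ : y - c - (z - c) = y - z)//; ring.
  - by move=> y; rewrite lt_min sxE => /andP[].
move: H; rewrite /h; under eq_Rintegral do rewrite mulrBr.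
rewrite RintegralB//.
- by move=> /eqP; rewrite subr_eq0 => /eqP.
- apply: (@bounded_integrable _ _ _ _ _ 1); first exact: measurable_funM.
  by move=> w; exact: bnd.
- apply: (@bounded_integrable _ _ _ _ _ 1); first exact: measurable_funM.
  by move=> w; exact: bnd.
Qed.

Let mN0 x : measurable (nonvanishing_oc (restarted x) s t).
Proof.
apply: measurable_nonvanishing_oc => // [u _|].
  exact: measurable_restarted.
exact: restarted_continuous.
Qed.

(** From [1 - exp (- a) <= a]. The bound tends to 0 with the starting point [x], which [hit_from0]
    needs. *)
Lemma no_hit_prob_le x y : no_hit_prob x y <= 2 / (t - s) * (`|x| * `|y|).
Proof.
have h0 : 0 <= 2 / (t - s) by rewrite divr_ge0// subr_ge0 ltW.
rewrite /no_hit_prob ge_max; apply/andP; split; last first.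
  by apply: mulr_ge0 => //; exact: mulr_ge0.
apply: (@le_trans _ _ (2 / (t - s) * x * y)).
  have := expR_ge1Dx (- (2 / (t - s) * x * y)); lra.
by rewrite -mulrA ler_wpM2l// -normrM ler_norm.
Qed.

(* Started at 0, a path with no later zero keeps a constant sign, hence stays
   away from 0 when started at a small [e] of that sign. *)
Lemma hit_from0 : \int[P]_w (\1_(nonvanishing_oc (restarted 0) s t) w : R) = 0.
Proof.
pose N0 := nonvanishing_oc (restarted 0) s t.
pose e (n : nat) : R := n.+1%:R^-1.
have e0 n : 0 < e n by rewrite invr_gt0.
have e1 n : e n <= 1 by rewrite invf_le1 ?ler1n.
have restartedE x u w : restarted x u w = x + restarted 0 u w.
  by rewrite /restarted; ring.
pose Fw (k : R) n w := no_hit_prob (k * e n) (restarted (k * e n) t w).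
have mFw k n : measurable_fun setT (Fw k n).
  by apply: measurable_no_hit_prob => //; exact: measurable_restarted.
have Fw1 k n w : `|Fw k n w| <= 1.
  by rewrite ger0_norm ?no_hit_prob_le1// no_hit_prob_ge0.
have Fwcvg k : `|k| = 1 -> \int[P]_w Fw k n w @[n --> \oo] --> (0 : R).
  move=> k1; rewrite [X in _ --> X](_ : _ = \int[P]_w cst 0 w); last first.
    by rewrite Rintegral_cst// mul0r.
  apply: (@bounded_cvg_Rintegral _ _ _ P (Fw k) (cst 0) 1) => // w.
  (* Started at [k * e n], the value at [t] is at most [e n + |restarted 0 t w|] in modulus, and
     [e n <= 1]; hence the bound [C * e n]. *)
  pose C := 2 / (t - s) * (1 + `|restarted 0 t w|).
  apply: (@squeeze_cvgr _ _ _ _ (cst 0) (fun n => C * e n)).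
  - apply: nearW => n; rewrite no_hit_prob_ge0/=.
    apply: (le_trans (no_hit_prob_le _ _)).
    rewrite /C -[leRHS]mulrA; apply: ler_wpM2l; first by rewrite divr_ge0// subr_ge0 ltW.
    have ke : `|k * e n| = e n by rewrite normrM k1 mul1r gtr0_norm.
    rewrite ke mulrC; apply: ler_wpM2r; first exact: ltW.
    rewrite restartedE; apply: (le_trans (ler_normD _ _)).
    by rewrite ke lerD2r.
  - exact: cvg_cst.
  - rewrite -[X in _ --> X](mulr0 C); apply: cvgM; first exact: cvg_cst.
    exact: cvg_harmonic.
have int1 n k : k * e n != 0 ->
    \int[P]_w (\1_(nonvanishing (restarted (k * e n)) s t) w : R) = \int[P]_w Fw k n w.
  move=> ke0; have := no_hit_law_neq0 ke0 measurableT.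
  under eq_Rintegral do rewrite indicT mul1r.
  by under [in X in _ = X -> _]eq_Rintegral do rewrite indicT mul1r.
have intN x : P.-integrable setT (EFin \o (\1_(nonvanishing (restarted x) s t) : T -> R)).
  apply: (@bounded_integrable _ _ _ _ _ 1).
    by apply/measurable_indicP; exact: mN.
  by move=> w; rewrite indicE; case: (_ \in _); rewrite ?normr1 ?normr0.
have intN0 : P.-integrable setT (EFin \o (\1_N0 : T -> R)).
  apply: (@bounded_integrable _ _ _ _ _ 1).
    by apply/measurable_indicP; exact: mN0.
  by move=> w; rewrite indicE; case: (_ \in _); rewrite ?normr1 ?normr0.
have bound n : \int[P]_w (\1_N0 w : R) <= \int[P]_w Fw 1 n w + \int[P]_w Fw (-1) n w.
  rewrite -!int1 ?mul1r ?mulN1r ?oppr_eq0 ?gt_eqF// -RintegralD//.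
  apply: le_Rintegral => //.
    exact: (integrableD measurableT (intN _) (intN _)).
  move=> w _; rewrite /= !indicE.
  have [|_] := boolP (w \in N0); last by rewrite addr_ge0.
  rewrite inE => N0w.
  (* The intermediate value argument is run on [[u, t]], which avoids the zero at [s]. *)
  have sign u : s < u <= t -> 0 < restarted 0 u w * restarted 0 t w.
    move=> /andP[su ut].
    have sub : `[u, t]%classic `<=` `[s, t]%classic.
      by move=> v /=; rewrite !in_itv/= => /andP[uv ->]; rewrite (le_trans (ltW su)).
    apply: (nonvanishing_sign (f := restarted 0 ^~ w) ut
      (continuous_subspaceW sub (@restarted_continuous 0 w))).
    by move=> v /andP[uv vt]; apply: N0w; rewrite vt (lt_le_trans su).
  have t0 : restarted 0 t w != 0 by apply: N0w; rewrite st lexx.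
  have [tpos|tneg] := ltP 0 (restarted 0 t w).
    rewrite (_ : w \in nonvanishing (restarted (e n)) s t) ?lerDl//.
    rewrite inE => u /andP[]; rewrite le_eqVlt => /predU1P[<-|su] ut.
      by rewrite restarted_start gt_eqF.
    rewrite restartedE gt_eqF// addr_gt0//.
    by have := sign u; rewrite su ut => /(_ isT); rewrite pmulr_lgt0.
  have {}tneg : restarted 0 t w < 0 by rewrite lt_neqAle t0.
  rewrite (_ : w \in nonvanishing (restarted (- e n)) s t) ?lerDr//.
  rewrite inE => u /andP[]; rewrite le_eqVlt => /predU1P[<-|su] ut.
    by rewrite restarted_start oppr_eq0 gt_eqF.
  rewrite restartedE lt_eqF// -oppr_gt0 opprD opprK addr_gt0// oppr_gt0.
  by have := sign u; rewrite su ut => /(_ isT); rewrite nmulr_lgt0.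
have Fcvg : \int[P]_w Fw 1 n w + \int[P]_w Fw (-1) n w @[n --> \oo] --> (0 : R).
  rewrite -[X in _ --> X]addr0; apply: cvgD; apply: Fwcvg.
    exact: normr1.
  exact: normrN1.
apply/eqP; rewrite eq_le Rintegral_ge0 ?andbT//.
apply: (closed_cvg (fun z => \int[P]_w (\1_N0 w : R) <= z)) Fcvg.
- exact: closed_ge.
- exact: nearW.
Qed.

(** For [x != 0] the path is nonzero at [s], so opening the interval there changes nothing. For
    [x = 0] both sides vanish, the left one by [hit_from0]. *)
Lemma no_hit_law x (D : set R) : measurable D ->
  \int[P]_w (\1_D (restarted x t w) * \1_(nonvanishing_oc (restarted x) s t) w) =
  \int[P]_w (\1_D (restarted x t w) * no_hit_prob x (restarted x t w)).
Proof.
move=> mD; have [->|x0] := eqVneq x 0; last first.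
  rewrite -no_hit_law_neq0//; apply: eq_Rintegral => w _; congr (_ * _).
  congr (\1_ _ w); apply/seteqP; split => p nv u /andP[].
    rewrite le_eqVlt => /predU1P[<-|su] ut; first by rewrite restarted_start.
    by apply: nv; rewrite su.
  by move=> su ut; apply: nv; rewrite ltW.
have mi (A : set T) : measurable A -> measurable_fun setT (\1_A : T -> R).
  by move=> mA; exact/measurable_indicP.
have indic01 (S : Type) (A : set S) z : 0 <= (\1_A z : R) <= 1.
  by rewrite indicE; case: (_ \in _); rewrite lexx ler01.
transitivity (0 : R); last first.
  transitivity (\int[P]_w (cst 0 w : R)).
    by rewrite Rintegral_cst// mul0r.
  by apply: eq_Rintegral => w _; rewrite no_hit_prob_eq0 ?mulr0// mul0r.
have pos w : 0 <= (\1_D (restarted 0 t w) * \1_(nonvanishing_oc (restarted 0) s t) w : R).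
  have /andP[? _] := indic01 _ D (restarted 0 t w).
  by have /andP[? _] := indic01 _ (nonvanishing_oc (restarted 0) s t) w; rewrite mulr_ge0.
apply/eqP; rewrite eq_le Rintegral_ge0// andbT -[leRHS]hit_from0.
apply: le_Rintegral => //.
- apply: (@bounded_integrable _ _ _ _ _ 1).
    apply: measurable_funM; last exact: mi.
    apply: measurableT_comp; first exact/measurable_indicP.
    exact: measurable_restarted.
  move=> w; have /andP[? ?] := indic01 _ D (restarted 0 t w).
  have /andP[? ?] := indic01 _ (nonvanishing_oc (restarted 0) s t) w.
  by rewrite ger0_norm// mulr_ile1.
- apply: (@bounded_integrable _ _ _ _ _ 1); first exact: mi.
  move=> w; have /andP[? ?] := indic01 _ (nonvanishing_oc (restarted 0) s t) w.
  by rewrite ger0_norm.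
- move=> w _; have /andP[? ?] := indic01 _ D (restarted 0 t w).
  have /andP[? ?] := indic01 _ (nonvanishing_oc (restarted 0) s t) w.
  by rewrite ler_piMl.
Qed.

End bridge.

(** * Conditional probability *)

(** Transport [P] to the sigma-algebra generated by [C] through the identity: there both versions
    are measurable and have the same integral on every measurable set. The exceptional set found
    there is also measurable in [T]. *)
Lemma cond_prob_unique d (T : measurableType d) (R : realType) (P : probability T R)
    (C : set (set T)) (A : set T) (Z Z' : T -> R) : C `<=` measurable ->
  cond_prob P C A Z -> cond_prob P C A Z' -> {ae P, forall w, Z w = Z' w}.
Proof.
move=> Cm [mZ intZ ZE] [mZ' intZ' Z'E].
pose TC := g_sigma_algebraType C.
have mid : measurable_fun setT (id : T -> TC).
  by move=> _ E mE; rewrite setTI; exact: g_sigma_measurable Cm _ mE.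
pose idC := HB.pack_for {mfun T >-> TC} (id : T -> TC)
  (isMeasurableFun.Build _ _ _ _ _ mid).
pose PC : probability TC R := distribution P idC.
have intC (f : TC -> R) : measurable_fun setT f -> P.-integrable setT (EFin \o f) ->
    PC.-integrable setT (EFin \o f).
  move=> mf intf; apply: (integrable_pushforward mid) => //.
  exact/measurable_EFinP.
have integralC (f : TC -> R) E : measurable_fun setT f ->
    P.-integrable setT (EFin \o f) ->
    measurable E -> (\int[PC]_(w in E) (f w)%:E = \int[P]_(w in E) (f w)%:E)%E.
  move=> mf intf mE; rewrite (integral_pushforward mid)//.
  - exact/measurable_EFinP.
  - apply: (integrableS measurableT) => //.
    exact: g_sigma_measurable Cm _ mE.
have [|||N [mN PN0 NE]] := @integral_ae_eq _ TC R PC setT measurableT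
    (EFin \o Z') (EFin \o Z).
- exact: intC.
- exact/measurable_EFinP.
- by move=> E _ mE; rewrite !integralC// ZE// Z'E.
exists N; split => //; first exact: g_sigma_measurable Cm _ mN.
by move=> w /= nZ; apply: NE => /= H; apply: nZ; have [] := H I.
Qed.

Lemma last_passage_leE (T : Type) (R : realType) (B : R -> T -> R) (nu l s t : R) :
  0 <= s -> [set w | last_passage B nu l t w <= s] =
    nonvanishing_oc (fun u w => drifted B nu u w - l) s t.
Proof.
move=> s0; apply/seteqP; split => w /=.
  move=> gs u /andP[su ut]; apply/negP; rewrite subr_eq0 => /eqP Xu.
  have : u <= last_passage B nu l t w.
    apply: ub_le_sup; first by exists t => v [/andP[]].
    by split => //; rewrite ut (le_trans s0 (ltW su)).
  by rewrite leNgt (le_lt_trans gs su).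
move=> nv; rewrite /last_passage; set S := [set _ | _].
(* If the level is never visited, the supremum is 0 by convention, and [0 <= s] puts this case in
   the event. *)
have [->|/set0P S0] := eqVneq S set0; first by rewrite sup0.
apply: ge_sup => // u [/andP[u0 ut] Xu]; rewrite leNgt; apply/negP => su.
by have := nv u; rewrite su ut Xu subrr eqxx => /(_ isT).
Qed.

Section conditional_law.
Context d (T : measurableType d) (R : realType) (P : probability T R).
Variables (B : R -> {RV P >-> R}) (nu l s t : R).
Hypotheses (BM : brownian_motion B) (s0 : 0 <= s) (st : s < t).

Let outer := gen_family (outer_idx s t) (outer_var B s t).
Let inner := gen_family (inner_idx s t) (inner_var B s).
Let T1 := g_sigma_algebraType outer.
Let T2 := g_sigma_algebraType inner.

Lemma past_future_measurable : past_future B s t `<=` measurable.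
Proof. exact: gen_family_measurable. Qed.

(** The first coordinate sees only the outer variables. The second is the one quantity that the
    conditioning retains from the path inside [[s, t]]. *)
Let split_at (w : T) : T1 * R := (w, B t w - B s w).

Let measurable_outer u : 0 <= u -> u <= s ->
  measurable_fun setT (B u : T1 -> R).
Proof.
move=> u0 us; have := @measurable_gen_family _ T R _ (outer_idx s t) (outer_var B s t) u.
by rewrite /outer_var us; apply; left; rewrite u0.
Qed.

Let measurable_inner u : s <= u <= t ->
  measurable_fun setT ((fun w => B u w - B s w) : T2 -> R).
Proof. exact: (@measurable_gen_family _ T R _ (inner_idx s t) (inner_var B s) u). Qed.

(** For [u >= t], write [B u] as [(B u - B t) + B s + (B t - B s)]: the first two terms are
    functions of the outer coordinate and the last is the second coordinate. *)
Let past_future_split (E : set T) : <<s past_future B s t >> E ->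
  exists2 E' : set (T1 * R), measurable E' & E = split_at @^-1` E'.
Proof.
suff : <<s past_future B s t >> `<=`
    preimage_set_system setT split_at (@measurable _ (T1 * R)%type).
  by move=> /[apply] -[E' mE' <-]; exists E' => //; rewrite setTI.
apply: smallest_sub.
  by apply: sigma_algebra_preimage; exact: sigma_algebra_measurable.
move=> _ [u /= ut [Y mY <-]].
have [us|su] := leP u s.
  have u0 : 0 <= u by case: ut => [/andP[]//|/(le_trans s0 \o le_trans (ltW st))].
  exists ((fun z : T1 * R => B u z.1) @^-1` Y) => //.
  rewrite -[X in measurable X]setTI.
  exact: (measurableT_comp (measurable_outer u0 us) measurable_fst).
have tu : t <= u by case: ut => // /andP[_]; rewrite leNgt su.
exists ((fun z : T1 * R => (B u z.1 - B t z.1) + (B s z.1 + z.2)) @^-1` Y); last first.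
  rewrite !setTI; apply/seteqP; split => w; rewrite /split_at/=.
    by rewrite (_ : B u w - B t w + _ = B u w)//; ring.
  by rewrite (_ : B u w - B t w + _ = B u w)//; ring.
rewrite -[X in measurable X]setTI.
have mu : measurable_fun setT ((fun w => B u w - B t w) : T1 -> R).
  have := @measurable_gen_family _ T R _ (outer_idx s t) (outer_var B s t) u.
  by rewrite /outer_var leNgt su/=; apply; right.
have mf : measurable_fun setT
    (fun z : T1 * R => (B u z.1 - B t z.1) + (B s z.1 + z.2)).
  apply: measurable_funD; first exact: (measurableT_comp mu measurable_fst).
  apply: measurable_funD => //.
  exact: (measurableT_comp (measurable_outer s0 (lexx s)) measurable_fst).
exact: mf.
Qed.

Let A := nonvanishing_oc (fun u w => drifted B nu u w - l) s t.
Let Z w := no_hit_prob s t (drifted B nu s w - l) (drifted B nu t w - l).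

Let restartedE u w : restarted B nu s (drifted B nu s w - l) u w = drifted B nu u w - l.
Proof. by rewrite /restarted /drifted; ring. Qed.

(** This is the freezing of the past: independence replaces [(w, w)] by a pair [(w1, w2)], and for
    fixed [w1] the claim is [no_hit_law] with a constant starting point. *)
Let no_hit_split (E' : set (T1 * R)) : measurable E' ->
  \int[P]_w (\1_E' (split_at w) * \1_A w) = \int[P]_w (\1_E' (split_at w) * Z w).
Proof.
move=> mE'.
have mid1 : measurable_fun setT (id : T -> T1).
  move=> _ E mE; rewrite setTI; apply: g_sigma_measurable _ _ mE.
  by apply: gen_family_measurable => i _; exact: measurable_outer_var.
have mid2 : measurable_fun setT (id : T -> T2).
  move=> _ E mE; rewrite setTI; apply: g_sigma_measurable _ _ mE.
  by apply: gen_family_measurable => i _; exact: measurable_inner_var.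
have ind : forall E F, measurable E -> measurable F ->
    (P (((id : T -> T1) @^-1` E) `&` ((id : T -> T2) @^-1` F)) =
     P ((id : T -> T1) @^-1` E) * P ((id : T -> T2) @^-1` F))%E.
  by move=> E F; exact: (outer_inner_indep BM s0 st).
pose x0 (w : T) := drifted B nu s w - l.
have mx0 : measurable_fun setT (x0 : T1 -> R).
  apply: measurable_funB => //; apply: measurable_funD => //.
  exact: measurable_outer.
(* The starting point is read from the outer copy and the increments from the inner copy; on the
   diagonal this is the original path. *)
pose path (u : R) (z : T1 * T2) := restarted B nu s (x0 z.1) u z.2.
have mpath u : s <= u <= t -> measurable_fun setT (path u).
  move=> su; apply: measurable_funD => //; apply: measurable_funD.
    exact: (measurableT_comp mx0 measurable_fst).
  exact: (measurableT_comp (measurable_inner su) measurable_snd).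
have tst : s <= t <= t by rewrite lexx ltW.
pose J (z : T1 * T2) : R := \1_E' (z.1, B t z.2 - B s z.2).
have mJ : measurable_fun setT J.
  apply: (@measurableT_comp _ _ _ _ _ _ (\1_E' : T1 * R -> R)).
    exact/measurable_indicP.
  apply/measurable_fun_pair; first exact: measurable_fst.
  exact: (measurableT_comp (measurable_inner tst) measurable_snd).
pose H1 (z : T1 * T2) : R := J z * \1_(nonvanishing_oc path s t) z.
pose H2 (z : T1 * T2) : R := J z * no_hit_prob s t (x0 z.1) (path t z).
have J01 z : 0 <= J z <= 1.
  by rewrite /J indicE; case: (_ \in _); rewrite lexx ler01.
have mH1 : measurable_fun setT H1.
  apply: measurable_funM => //; apply/measurable_indicP.
  apply: measurable_nonvanishing_oc => // z.
  exact: restarted_continuous.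
have mH2 : measurable_fun setT H2.
  apply: measurable_funM => //; apply: measurable_no_hit_prob; last exact: mpath.
  exact: (measurableT_comp mx0 measurable_fst).
have H1b z : `|H1 z| <= 1.
  have /andP[? ?] := J01 z; rewrite /H1 indicE.
  by case: (_ \in _); rewrite ?mulr1 ?mulr0 ?normr0// ger0_norm.
have H2b z : `|H2 z| <= 1.
  have /andP[? ?] := J01 z.
  by rewrite ger0_norm ?mulr_ge0 ?mulr_ile1 ?no_hit_prob_ge0 ?no_hit_prob_le1.
have -> : \int[P]_w (\1_E' (split_at w) * \1_A w) = \int[P]_w H1 (w, w).
  apply: eq_Rintegral => w _; rewrite /H1; congr (_ * _).
  rewrite !indicE; congr (_%:R); congr nat_of_bool.
  by apply/idP/idP; rewrite !inE => nv u /nv; rewrite /path/= restartedE.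
have -> : \int[P]_w (\1_E' (split_at w) * Z w) = \int[P]_w H2 (w, w).
  by apply: eq_Rintegral => w _; rewrite /H2 /Z /path/= restartedE.
rewrite (indep_Fubini mid1 mid2 ind mH1 H1b) (indep_Fubini mid1 mid2 ind mH2 H2b).
apply: eq_Rintegral => w1 _.
(* The section of [E'] at [w1], expressed through the end value [y] of the restarted path, from
   which [B t - B s] is recovered by subtraction. *)
pose D : set R := [set y | E' (w1, y - x0 w1 - nu * (t - s))].
have mD : measurable D.
  have mg : measurable_fun setT (fun y : R => ((w1 : T1), y - x0 w1 - nu * (t - s))).
    apply/measurable_fun_pair; first exact: measurable_cst.
    by apply: measurable_funB => //; exact: measurable_funB.
  by rewrite -[X in measurable X]setTI; exact: mg.
have JD w2 : J (w1, w2) = \1_D (restarted B nu s (x0 w1) t w2).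
  rewrite /J !indicE; congr (_%:R); congr nat_of_bool.
  have e : B t w2 - B s w2 = restarted B nu s (x0 w1) t w2 - x0 w1 - nu * (t - s).
    by rewrite /restarted; ring.
  by apply/idP/idP; rewrite !inE /D/= e.
transitivity (\int[P]_w2 (\1_D (restarted B nu s (x0 w1) t w2) *
    \1_(nonvanishing_oc (restarted B nu s (x0 w1)) s t) w2)).
  by apply: eq_Rintegral => w2 _; rewrite /H1 JD; congr (_ * _).
rewrite (no_hit_law nu BM s0 st)//.
by apply: eq_Rintegral => w2 _; rewrite /H2 JD.
Qed.

Lemma last_passage_measurable : measurable A.
Proof.
have -> : A = nonvanishing_oc
    (fun u w => restarted B nu s (drifted B nu s w - l) u w) s t.
  by apply/seteqP; split => w nv u /nv; rewrite restartedE.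
apply: measurable_nonvanishing_oc => // [u _|w].
  apply: (@eq_measurable_fun _ _ _ _ _ (fun w => drifted B nu u w - l)).
    by move=> w _; rewrite restartedE.
  by apply: measurable_funB => //; exact: measurable_funD.
exact: restarted_continuous.
Qed.

(** An event [E] of the conditioning is a preimage under [split_at], so the integral identity is
    [no_hit_split], up to the passage between real and extended integrals. *)
Lemma last_passage_cond_prob : cond_prob P (past_future B s t) A Z.
Proof.
have mBpf u : 0 <= u <= s \/ t <= u ->
    measurable_fun setT (B u : g_sigma_algebraType (past_future B s t) -> R).
  exact: (@measurable_gen_family _ T R _ [set u | 0 <= u <= s \/ t <= u] B).
have mZpf : measurable_fun setT (Z : g_sigma_algebraType (past_future B s t) -> R).
  apply: measurable_no_hit_prob; apply: measurable_funB => //;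
    apply: measurable_funD => //; apply: mBpf.
    by left; rewrite s0 lexx.
  by right.
have mZ : measurable_fun setT Z.
  apply: measurable_no_hit_prob; apply: measurable_funB => //; exact: measurable_funD.
have Z1 w : `|Z w| <= 1 by rewrite ger0_norm ?no_hit_prob_le1 ?no_hit_prob_ge0.
have mA := last_passage_measurable.
split => //; first exact: (@bounded_integrable _ _ _ _ _ 1).
move=> E sE; have mE : measurable E.
  exact: g_sigma_measurable past_future_measurable _ sE.
have [E' mE' EE'] := past_future_split sE.
have E1 w : \1_E w = \1_E' (split_at w) :> R.
  by rewrite EE' !indicE; congr (_%:R); congr nat_of_bool; apply/idP/idP; rewrite !inE.
have m1 F : measurable F -> measurable_fun setT (\1_F : T -> R).
  by move=> mF; exact/measurable_indicP.
have intb (f : T -> R) : measurable_fun setT f -> (forall w, `|f w| <= 1) ->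
    (\int[P]_w (f w)%:E)%E = (\int[P]_w f w)%:E.
  move=> mf f1; rewrite /Rintegral fineK//.
  by apply: integrable_fin_num => //; exact: (@bounded_integrable _ _ _ _ _ 1).
have b1 F w : `|\1_F w : R| <= 1.
  by rewrite indicE; case: (_ \in _); rewrite ?normr1 ?normr0.
transitivity (\int[P]_w (\1_E w * Z w)%:E)%E.
  rewrite integral_mkcond; apply: eq_integral => w _.
  by rewrite patchE indicE; case: (_ \in _); rewrite ?mul1r ?mul0r.
rewrite intb; last 2 first.
- by apply: measurable_funM => //; exact: m1.
- by move=> w; rewrite normrM mulr_ile1.
under eq_Rintegral do rewrite E1.
rewrite -no_hit_split//.
under eq_Rintegral do rewrite -E1.
rewrite -intb; last 2 first.
- by apply: measurable_funM; exact: m1.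
- by move=> w; rewrite normrM mulr_ile1.
transitivity (\int[P]_w (\1_(A `&` E) w)%:E)%E.
  by apply: eq_integral => w _; rewrite indicI/= mulrC.
by rewrite integral_indic ?setIT//; exact: measurableI.
Qed.

End conditional_law.

(** The existence clause keeps the statement about all versions from being vacuous. *)
Theorem theorem6p1 (d : measure_display) (T : measurableType d) (R : realType)
    (P : probability T R) (B : R -> {RV P >-> R}) (nu l s t : R) :
  brownian_motion B -> 0 <= s -> s < t ->
  let A := [set w | last_passage B nu l t w <= s] in
  [/\ measurable A,
      exists Z : T -> R, cond_prob P (past_future B s t) A Z &
      forall Z : T -> R, cond_prob P (past_future B s t) A Z ->
        {ae P, forall w, Z w =
          Num.max (1 - expR (- (2 / (t - s)
            * (drifted B nu s w - l) * (drifted B nu t w - l)))) 0}].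
Proof.
move=> BM s0 st A; rewrite /A last_passage_leE//.
have cpZ := last_passage_cond_prob nu l BM s0 st.
split; first exact: last_passage_measurable BM s0 st.
- by eexists; exact: cpZ.
- move=> Z cZ; apply: cond_prob_unique cZ cpZ.
  exact: past_future_measurable.
Qed.
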